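(* Let $a$ be a fixed positive integer. Then for every real number $z$, $$\lim_{N\to\infty}\frac1N\,\mathrm{card}\left\{3\le n\le N:\ \frac{\log R(n;a)-(\log 3)\log\log n}{(\log 3)\sqrt{\log\log n}}\le z\right\}=\Phi(z),$$ where $\Phi(z)=\frac1{\sqrt{2\pi}}\int_{-\infty}^{z}e^{-t^2/2}\,dt$.
   Context: For positive integers $n,a$, $R(n;a)$ denotes the number of ordered pairs $(x,y)$ of positive integers with $\frac an=\frac1x+\frac1y$. Here $n$ ranges over integers, not required to be coprime to $a$. Convention: if $R(n;a)=0$ then $\log R(n;a)=-\infty$, so the displayed inequality is regarded as holding for such $n$. *)

(* Defs.v *)
From HB Require Import structures.
From mathcomp Require Import all_boot all_order all_algebra.
From mathcomp Require Import finmap zify ring lra.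
From mathcomp Require Import all_classical all_reals all_analysis.

Set Implicit Arguments.
Unset Strict Implicit.
Unset Printing Implicit Defensive.

Import Order.TTheory GRing.Theory Num.Theory.

Local Open Scope classical_set_scope.
Local Open Scope ring_scope.

Definition representations (n a : nat) : set (nat * nat) :=
  [set p | [/\ (0 < p.1)%N, (0 < p.2)%N &
            a%:R / n%:R = 1 / p.1%:R + 1 / p.2%:R :> rat]].

Lemma finite_representations (n a : nat) :
  (0 < n)%N -> (0 < a)%N -> finite_set (representations n a).
Proof.
move=> n0 a0.
apply: (@sub_finite_set _ _ (`I_(n * n.+1).+1 `*` `I_(n * n.+1).+1)); last first.
  by apply: finite_setX; apply: finite_II.
case=> x y [/= x0 y0 E].
have {}E : (a * (x * y) = n * (x + y))%N.
  apply/eqP; rewrite -(eqr_nat rat) !natrM natrD; apply/eqP.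
  have nn : n%:R != 0 :> rat by rewrite pnatr_eq0 -lt0n.
  have xn : x%:R != 0 :> rat by rewrite pnatr_eq0 -lt0n.
  have yn : y%:R != 0 :> rat by rewrite pnatr_eq0 -lt0n.
  have -> : a%:R * (x%:R * y%:R) = n%:R * (x%:R * y%:R) * (a%:R / n%:R) :> rat.
    by field.
  by rewrite E; field; rewrite xn yn.
have bound u v : (0 < u)%N -> (0 < v)%N ->
    (a * (u * v) = n * (u + v))%N -> (u < (n * n.+1).+1)%N.
  move=> u0 v0 e.
  have v1 : (n < a * v)%N by nia.
  have e2 : (u * (a * v - n) = n * v)%N by nia.
  have : (n * v <= n * (a * v))%N by nia.
  nia.
by split; [apply: (bound x y)|apply: (bound y x) => //; nia].
Qed.

(* [fset_set] is [fset0] on infinite sets; for n, a > 0 this does not occur,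
   by [finite_representations]. *)
Definition repr_count (n a : nat) : nat := #|` fset_set (representations n a)|.

(* [lne 0 = -oo], so that the value is -oo when [repr_count n a = 0]
   (for n >= 3, the denominator is a positive real). *)
Definition normalized_log_count (R : realType) (a n : nat) : \bar R :=
  ((lne ((repr_count n a)%:R%:E) - (ln 3%:R * ln (ln n%:R))%:E)
     / (ln 3%:R * Num.sqrt (ln (ln n%:R)))%:E)%E.

Definition Phi (R : realType) (z : R) : R :=
  1 / Num.sqrt (2 * pi) *
  Rintegral lebesgue_measure `]-oo, z] (fun t : R => expR (- (t ^+ 2 / 2))).

Definition distribution_count (R : realType) (a : nat) (z : R) (N : nat) : nat :=
  #|[set n : 'I_N.+1 | (3 <= n)%N && (normalized_log_count R a n <= z%:E)%E]%SET|.

(* Main.v *)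
(* Since a/n = 1/x + 1/y amounts to (a x - n)(a y - n) = n^2, the number of
   solutions is at most the number of divisors of n^2, hence at most
   3 ^ Omega(n).  Conversely, a squarefree divisor D of n coprime to b = 2 a and
   a divisor e of D^2 with e = - D mod b give a solution.  Choosing greedily
   boundedly many primes whose products p1^i1 p2^i2 ... (each i <= 2) already
   meet every unit class mod b leaves the exponents 0, 1, 2 of all other primes
   free, so the count is at least 3 ^ (omega'(n) - C), where omega' counts the
   prime factors coprime to b.  The choice can only fail if, for some proper
   submonoid K of the units, few prime factors of n lie outside K; as the primes
   outside K have divergent reciprocal sum (a small tail would contradict a count
   of the integers n = r mod b, for a unit r outside K, that are free of the
   small primes outside K), this happens on a set of density 0.

   It remains to see that omega' and Omega are asymptotically normal.  Let W(n)
   be the number of prime factors of n in (log^3 N, N^(1 / (20 log log N))].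
   Then W <= omega' <= Omega for n <= N and N large, and by Mertens' theorems the
   average of Omega - W is O((log log N)^(1/4)), so that it is enough to treat W.
   The binomial moments of W are sums over products of distinct primes, and by
   inclusion-exclusion W is close in law to a Poisson variable of mean
   log log N + O((log log N)^(1/4)), whose distribution function, properly
   normalized, tends to Phi. *)

Require Import Defs.
From mathcomp Require Import all_boot all_order all_algebra.
From mathcomp Require Import finmap zify ring lra.
From mathcomp Require Import all_classical all_reals all_analysis.
From mathcomp Require Import measurable_realfun.

Import Order.TTheory GRing.Theory Num.Theory numFieldNormedType.Exports.

Set Implicit Arguments.
Unset Strict Implicit.
Unset Printing Implicit Defensive.

Local Open Scope classical_set_scope.
Local Open Scope ring_scope.

(** * The Poisson distribution function tends to the normal one *)

(** The cuts that define W answer two errors of inclusion-exclusion. An indicator of W <= m expands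
    in the binomials of W with coefficients as large as 2^r, so the r-th moment must match lam^r /
    r! even with weight 2^r. Repeated primes spoil this match by about e^(2 lam) times the sum of
    1/p^2, and since e^(2 lam) is about log^2 N, the primes must exceed log^3 N. Rounding N / (p1
    ... pr) to an integer costs up to Y^r / N for primes below Y; moments of order up to about 10
    log log N have to be kept, which forces Y to be N to a power of order 1 / log log N. Both cuts
    remove a mass of order log log log N only, far below the scale sqrt(log log N). On that scale
    the bounded factor 3^C also disappears, and so does the difference between log log n and log log
    N, which is at most 1 for eps N <= n <= N. *)

Section PoissonLimit.
Context {R : realType}.
Implicit Types (l s x v : R) (m n k : nat).

Definition poisson_cdf l m : R :=
  expR (- l) * \sum_(k < m.+1) l ^+ k / k`!%:R.

Lemma poisson_cdf0 m : poisson_cdf 0 m = 1.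
Proof.
rewrite /poisson_cdf oppr0 expR0 mul1r big_ord_recl expr0 divr1 big1 ?addr0//.
by move=> i _; rewrite expr0n mul0r.
Qed.

Lemma poisson_cdfS l m : poisson_cdf l m.+1 =
  poisson_cdf l m + expR (- l) * (l ^+ m.+1 / m.+1`!%:R).
Proof. by rewrite /poisson_cdf big_ord_recr/= mulrDr. Qed.

(** The derivative of each Poisson weight is the previous weight minus itself, so the sum telescopes
    and only the last weight remains. *)
Lemma is_derive_poisson_cdf m l :
  is_derive l 1 (poisson_cdf ^~ m) (- (expR (- l) * (l ^+ m / m`!%:R))).
Proof.
elim: m => [|m IH].
  have -> : poisson_cdf ^~ 0%N = expR \o -%R.
    by apply/funext => t; rewrite /poisson_cdf big_ord1 expr0 divr1 mulr1.
  by apply: is_derive_eq; rewrite expr0 divr1 mulr1 mulrN1.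
have -> : poisson_cdf ^~ m.+1 = (poisson_cdf ^~ m) +
    (expR \o -%R) * ((m.+1`!%:R)^-1 *: (@GRing.exp R ^~ m.+1)).
  apply/funext => t; rewrite poisson_cdfS; congr (_ + _).
  by congr (_ * _); exact: mulrC.
have D1 : is_derive l 1 (expR \o -%R : R -> R) (- expR (- l)).
  by apply: is_derive_eq; rewrite mulrN1.
have D2 : is_derive l 1 (@GRing.exp R ^~ m.+1) (m.+1%:R * l ^+ m).
  have -> : @GRing.exp R ^~ m.+1 = id ^+ m.+1 by apply/funext => t; rewrite exprfctE.
  by rewrite -[X in is_derive _ _ _ X]mulr1; exact: (is_deriveX m.+1 (is_derive_id l 1)).
have -> : - (expR (- l) * (l ^+ m.+1 / m.+1`!%:R)) =
    - (expR (- l) * (l ^+ m / m`!%:R)) + (expR (- l) *: (m.+1`!%:R^-1 *: (m.+1%:R * l ^+ m)) +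
      (m.+1`!%:R^-1 * l ^+ m.+1) *: (- expR (- l))).
  rewrite -![_ *: _]/(_ * _) factS natrM.
  have : m`!%:R != 0 :> R by rewrite pnatr_eq0 -lt0n fact_gt0.
  have : m.+1%:R != 0 :> R by rewrite pnatr_eq0.
  move: (m.+1%:R) (m`!%:R) => u v u0 v0.
  by field; rewrite ?u0 ?v0.
by apply: is_deriveD; apply: is_deriveM.
Qed.

Lemma cvg_poisson_cdf m : poisson_cdf l m @[l --> +oo] --> 0.
Proof.
apply: (@squeeze_cvgr _ _ _ _ (cst 0) (fun l => (\sum_(k < m.+1) k.+1%:R) * l^-1)).
- near=> l.
  have l0 : 0 < l by near: l; exact: nbhs_pinfty_gt.
  rewrite /poisson_cdf mulr_ge0 ?expR_ge0 ?sumr_ge0 ?andTb//=; last first.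
    by move=> k _; rewrite divr_ge0 ?exprn_ge0// ltW.
  rewrite big_distrr big_distrl /= ler_sum// => k _.
  rewrite expRN mulrC ler_pdivrMr ?expR_gt0// -mulrA ler_pdivrMr ?ltr0n ?fact_gt0//.
  (* Since l^(k+1) / (k+1)! <= e^l, the k-th Poisson weight is at most (k+1) / l. *)
  have := expR_ge1Dxn k (ltW l0); rewrite factS natrM.
  have f0 : 0 < (k`!)%:R :> R by rewrite ltr0n fact_gt0.
  move=> h.
  have {}h : l ^+ k.+1 <= k.+1%:R * k`!%:R * expR l.
    rewrite mulrC -ler_pdivrMr ?mulr_gt0// ?ltr0n//; apply: le_trans h; rewrite lerDr//.
  rewrite -(ler_pM2l l0) -exprS; apply: (le_trans h).
  by rewrite le_eqVlt; apply/orP; left; apply/eqP; field; rewrite gt_eqF.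
- exact: cvg_cst.
- rewrite -[X in _ --> X](mulr0 (\sum_(k < m.+1) k.+1%:R)).
  by apply: cvgMl_tmp; apply/gtr0_cvgV0; [exact: nbhs_pinfty_gt|exact: cvg_id].
Unshelve. all: by end_near. Qed.

(** The Poisson weight of m at mean m + s sqrt m, times sqrt m, factors as
    [poisson_peak m * poisson_shape m s]: the value at s = 0, and a profile equal to 1 at s = 0. *)
Definition poisson_peak m : R :=
  Num.sqrt m%:R * expR (- m%:R) * (m%:R ^+ m / m`!%:R).

Definition poisson_shape m s : R :=
  expR (- (s * Num.sqrt m%:R)) * (1 + s / Num.sqrt m%:R) ^+ m.

Lemma is_derive_poisson_cdf_affine m s : (0 < m)%N ->
  is_derive s 1 (fun s => poisson_cdf (m%:R + s * Num.sqrt m%:R) m)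
    (- (poisson_peak m * poisson_shape m s)).
Proof.
move=> m0.
have sm0 : 0 < Num.sqrt (m%:R : R) by rewrite sqrtr_gt0 ltr0n.
pose l : R := m%:R + s * Num.sqrt m%:R.
have dl : is_derive s 1 (fun s : R => m%:R + s * Num.sqrt m%:R) (Num.sqrt m%:R).
  have -> : (fun s : R => m%:R + s * Num.sqrt m%:R) = cst m%:R + Num.sqrt m%:R *: id.
    by apply/funext => t; rewrite fctE /= [X in _ + X]mulrC.
  have := is_deriveD (is_derive_cst (m%:R : R) s 1)
    (is_deriveZ (Num.sqrt m%:R : R) (is_derive_id s 1)).
  by rewrite add0r -[_ *: 1]/(_ * 1) mulr1.
have := @is_derive1_comp _ (poisson_cdf ^~ m) (fun s => m%:R + s * Num.sqrt m%:R) s _ _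
  (is_derive_poisson_cdf m l) dl.
congr (is_derive _ _ _ _).
have lE : l = m%:R * (1 + s / Num.sqrt m%:R).
  rewrite /l; move: sm0 (sqr_sqrtr (ler0n R m)).
  by move: (Num.sqrt _) => t t0 <-; field; rewrite gt_eqF.
rewrite {2}lE exprMn /l opprD expRD /poisson_peak /poisson_shape.
by rewrite mulNr; congr (- _); ring.
Qed.

(** With t = sqrt (1 + x), ln (1 + x) = 2 ln t <= 2 (t - 1). This is x - (t - 1)^2, while x^2 = (t -
    1)^2 (t + 1)^2 and (t + 1)^2 <= 4 + 2 |x|. The gain is quadratic near 0 and linear far away, as
    a uniform domination requires. *)
Lemma ln1Dx_le x : -1 < x -> ln (1 + x) <= x - x ^+ 2 / (4 + 2 * `|x|).
Proof.
move=> x1.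
have x0 : 0 < 1 + x by rewrite -ltrBlDl sub0r.
have [t t0 tE] : exists2 t, 0 < t & 1 + x = t ^+ 2.
  by exists (Num.sqrt (1 + x)); rewrite ?sqrtr_gt0// sqr_sqrtr// ltW.
have xE : x = t ^+ 2 - 1 by rewrite -tE addrC addKr.
have h : ln (1 + x) <= 2 * (t - 1).
  rewrite tE lnXn// -[_ *+ 2]mulr_natl ler_pM2l// -{1}[t](subrKC 1).
  by apply: le_ln1Dx; rewrite -subr_gt0 opprK subrK.
apply: (le_trans h); rewrite -subr_ge0.
have p0 : 0 < 4 + 2 * `|x| by rewrite ltr_pwDl// mulr_ge0.
have ub : (t + 1) ^+ 2 <= 4 + 2 * `|x|.
  have [xge|xlt] := leP 0 x.
    by have := sqr_ge0 (t - 1); rewrite ger0_norm//; nra.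
  have : t <= 1 by nra.
    by have := normr_ge0 x; nra.
move: p0 ub; move: (4 + 2 * `|x|) => D p0 ub.
have -> : x - x ^+ 2 / D - 2 * (t - 1) = (t - 1) ^+ 2 * (1 - (t + 1) ^+ 2 / D).
  by rewrite xE; field; rewrite gt_eqF.
by rewrite mulr_ge0 ?sqr_ge0// subr_ge0 ler_pdivrMr ?mul1r.
Qed.

(** The dominating function, uniform in m. With w = |s|, the previous bound saves at least w^2 / (4
    + 2 w) in the exponent because sqrt m >= 1, and this is at least w / 2 - 1 since (w / 2 - 1) (4
    + 2 w) = w^2 - 4. *)
Lemma poisson_shape_le m s : (0 < m)%N -> - Num.sqrt m%:R <= s ->
  poisson_shape m s <= expR (1 - `|s| / 2).
Proof.
move=> m0 sm.
have sm0 : 0 < Num.sqrt (m%:R : R) by rewrite sqrtr_gt0 ltr0n.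
rewrite /poisson_shape.
have t1 : 1 <= Num.sqrt (m%:R : R) by rewrite -[leLHS]sqrtr1 ler_wsqrtr// ler1n.
move: sm sm0 t1 (sqr_sqrtr (ler0n R m)).
move: (Num.sqrt _) => t sm sm0 t1 /esym mE.
(* At the endpoint 1 + s / t vanishes and has no logarithm; the shape is 0 there because m > 0. *)
have [->|st] := eqVneq s (- t).
  rewrite [- t / t]mulNr divff ?gt_eqF// subrr expr0n gtn_eqF//= mulr0; exact: expR_ge0.
have u1 : -1 < s / t.
  by rewrite ltr_pdivlMr// mulN1r lt_neqAle eq_sym st sm.
have v0 : 0 < 1 + s / t by rewrite -ltrBlDl sub0r.
rewrite -[(1 + _)]lnK// -expRM_natl -expRD ler_expR.
have h := ln1Dx_le u1.
have sE : s = (s / t) * t by rewrite divfK// gt_eqF.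
rewrite mE {1 3}sE normrM (gtr0_norm sm0).
move: (s / t) h => u h; have u0 := normr_ge0 u.
have uu : `|u| ^+ 2 = u ^+ 2 by rewrite real_normK// num_real.
have p0 : 0 < 4 + 2 * `|u| by nra.
have h2 : t ^+ 2 * ln (1 + u) <= t ^+ 2 * (u - u ^+ 2 / (4 + 2 * `|u|)).
  by rewrite ler_wpM2l// sqr_ge0.
suff : `|u| * t / 2 - 1 <= t ^+ 2 * (u ^+ 2 / (4 + 2 * `|u|)) by nra.
rewrite mulrA ler_pdivlMr// -uu.
set v := `|u| in u0 uu p0 *; have va : v <= v * t by nra.
have [h3|h3] := leP 2 (v * t); nra.
Qed.

Lemma is_derive_ln1Dx x : -1 < x ->
  is_derive x 1 (fun x : R => ln (1 + x)) (1 + x)^-1.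
Proof.
move=> x1; have x0 : 0 < 1 + x by rewrite -ltrBlDl sub0r.
have d1 : is_derive x 1 (fun x : R => 1 + x) 1.
  have := is_deriveD (is_derive_cst (1 : R) x 1) (is_derive_id x 1).
  by rewrite add0r.
by have := @is_derive1_comp _ (@ln R) (fun x => 1 + x) x _ _ (is_derive1_ln x0) d1; rewrite mulr1.
Qed.

(** The remainder vanishes at 0 and has derivative y^2 / (1 + y), at most 2 x^2 between 0 and x; the
    mean value theorem concludes. *)
Lemma ln1Dx_taylor2 x : `|x| <= 2^-1 ->
  `|ln (1 + x) - (x - x ^+ 2 / 2)| <= 2 * `|x| ^+ 3.
Proof.
move=> xle.
pose f (y : R) := ln (1 + y) - (y - y ^+ 2 / 2).
have df (y : R) : -1 < y -> is_derive y 1 f (y ^+ 2 / (1 + y)).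
  move=> y1; have y0 : 0 < 1 + y by rewrite -ltrBlDl sub0r.
  have := is_deriveB (is_derive_ln1Dx y1) (is_deriveB (is_derive_id y 1)
    (is_deriveZ (2^-1 : R) (is_deriveX 2 (is_derive_id y 1)))).
  rewrite -[_ *: (_ *: 1)]/(_ * (_ * 1)) mulr1 (_ : _ - _ = y ^+ 2 / (1 + y)).
    congr (is_derive _ _ _ _); apply/funext => z; rewrite /f; congr (_ - (_ - _)).
    by rewrite -[LHS]/(_ * _) mulrC exprfctE.
  by rewrite expr1; field; rewrite gt_eqF.
have f0 : f 0 = 0 by rewrite /f addr0 ln1 expr0n mul0r subrr subrr.
have cf (a b : R) : -1 < a -> {within `[a, b], continuous f}.
  move=> a1; apply: derivable_within_continuous => y /[!in_itv]/= /andP[ay _].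
  by have [] := df y (lt_le_trans a1 ay).
have bound (c : R) : `|c| <= `|x| -> `|c ^+ 2 / (1 + c)| <= 2 * `|x| ^+ 2.
  move=> cx; have c2 : - 2^-1 <= c.
    by have := ler_norm (- c); rewrite normrN => h; lra.
  have c0 : 0 < 1 + c by lra.
  rewrite ger0_norm ?divr_ge0 ?sqr_ge0 ?(ltW c0)// ler_pdivrMr//.
  have : c ^+ 2 <= `|x| ^+ 2 by rewrite -real_normK ?num_real// ler_sqr ?nnegrE.
  have := sqr_ge0 (`|x|); nra.
have x1 : - 2^-1 <= x by have := ler_norm (- x); rewrite normrN => h; lra.
rewrite -/(f x).
suff [c cx ->] : exists2 c : R, `|c| <= `|x| & f x = c ^+ 2 / (1 + c) * x.
  by rewrite normrM [X in 2 * X]exprSr mulrA ler_wpM2r// bound.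
have [x0|x0|->] := ltgtP x 0; last by exists 0; rewrite // mulr0.
- have [||c /[!in_itv]/= /andP[c1 c2]] :=
      @MVT_segment _ f (fun y => y ^+ 2 / (1 + y)) _ _ (ltW x0).
  + by move=> y /[!in_itv]/= /andP[y1 y2]; apply: df; lra.
  + by apply: cf; lra.
  rewrite f0 sub0r sub0r mulrN => /eqP; rewrite eqr_opp => /eqP fx.
  by exists c => //; rewrite !ler0_norm ?lerN2// ltW.
- have [||c /[!in_itv]/= /andP[c1 c2]] :=
      @MVT_segment _ f (fun y => y ^+ 2 / (1 + y)) _ _ (ltW x0).
  + by move=> y /[!in_itv]/= /andP[y1 y2]; apply: df; lra.
  + by apply: cf; lra.
  rewrite f0 !subr0 => fx.
  by exists c => //; rewrite !ger0_norm// ltW.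
Qed.

Lemma cvg_sqrt_natr : Num.sqrt (n%:R : R) @[n --> \oo] --> +oo.
Proof.
apply/cvgryPge => A; near=> n.
rewrite (le_trans (ler_norm A))// -sqrtr_sqr ler_wsqrtr//.
by near: n; exact: (cvgry_ge cvgr_idn).
Unshelve. all: by end_near. Qed.

Lemma cvg_poisson_shape s :
  poisson_shape n s @[n --> \oo] --> expR (- (s ^+ 2 / 2)).
Proof.
pose e n : R := - (s * Num.sqrt n%:R) + n%:R * ln (1 + s / Num.sqrt n%:R).
have sqy := cvg_sqrt_natr.
have nearE : \forall n \near \oo, (0 < n)%N /\ `|s / Num.sqrt n%:R| <= 2^-1.
  near=> n; split; first by near: n; exists 1%N.
  have h : 2 * `|s| + 1 <= Num.sqrt (n%:R : R) by near: n; exact: cvgry_ge.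
  have p : 0 < Num.sqrt (n%:R : R) by have := normr_ge0 s; lra.
  by rewrite normrM normfV (gtr0_norm p) ler_pdivrMr//; lra.
have nearexp : \forall n \near \oo, expR (e n) = poisson_shape n s.
  near=> n.
  have [n0 sn] : (0 < n)%N /\ `|s / Num.sqrt n%:R| <= 2^-1 by near: n.
  rewrite /e expRD expRM_natl lnK// posrE.
  by have := ler_norm (- (s / Num.sqrt n%:R)); rewrite normrN => h; lra.
apply: (cvg_trans (near_eq_cvg nearexp)).
apply: continuous_cvg; first exact: continuous_expR.
apply/cvgrPdist_le => eps eps0; near=> n.
have [n0 sn] : (0 < n)%N /\ `|s / Num.sqrt n%:R| <= 2^-1 by near: n.
have p : 0 < Num.sqrt (n%:R : R) by rewrite sqrtr_gt0 ltr0n.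
have h := ln1Dx_taylor2 sn.
have big : 2 * `|s| ^+ 3 / eps <= Num.sqrt (n%:R : R) by near: n; exact: cvgry_ge.
rewrite /e; move: p h big (sqr_sqrtr (ler0n R n)); move: (Num.sqrt _) => t p h big /esym nE.
rewrite nE.
have -> : - (s ^+ 2 / 2) - (- (s * t) + t ^+ 2 * ln (1 + s / t)) =
  - (t ^+ 2 * (ln (1 + s / t) - (s / t - (s / t) ^+ 2 / 2))).
  by field; rewrite gt_eqF.
rewrite normrN normrM (ger0_norm (sqr_ge0 _)).
apply: (le_trans (ler_wpM2l (sqr_ge0 t) h)).
rewrite normrM normfV (gtr0_norm p).
have -> : t ^+ 2 * (2 * (`|s| / t) ^+ 3) = 2 * `|s| ^+ 3 / t by field; rewrite gt_eqF.
by move: big; rewrite !ler_pdivrMr// [t * _]mulrC.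
Unshelve. all: by end_near. Qed.

(** Below - sqrt m the mean m + s sqrt m is negative and the domination fails. Extending by 0 puts
    all shapes on one domain, ready for dominated convergence. *)
Definition truncated_shape m s : R :=
  if - Num.sqrt m%:R <= s then poisson_shape m s else 0.

Lemma continuous_poisson_shape m : continuous (poisson_shape m).
Proof.
move=> s; apply: cvgM.
  apply: (@continuous_comp _ _ _ (fun s => - (s * Num.sqrt m%:R)) expR); last exact: continuous_expR.
  by apply: cvgN; apply: cvgMr_tmp; exact: cvg_id.
apply: (@continuous_comp _ _ _ (fun s => 1 + s / Num.sqrt m%:R) (fun t => t ^+ m)); last exact: exprn_continuous.
by apply: cvgD; [exact: cvg_cst|apply: cvgMr_tmp; exact: cvg_id].
Qed.

Lemma measurable_poisson_shape m : measurable_fun setT (poisson_shape m).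
Proof. by apply: continuous_measurable_fun; exact: continuous_poisson_shape. Qed.

Lemma measurable_truncated_shape m : measurable_fun setT (truncated_shape m).
Proof.
apply: measurable_fun_ifT => //; last exact: measurable_poisson_shape.
exact: measurable_fun_ler.
Qed.

Lemma is_derive_continuous (f : R -> R) x df : is_derive x 1 f df -> f @ x --> f x.
Proof. by case=> /derivable1_diffP /differentiable_continuous. Qed.

Lemma integrable_shape_bound :
  lebesgue_measure.-integrable setT (EFin \o (fun s : R => expR (1 - `|s| / 2))).
Proof.
have cf : continuous (fun s : R => expR (1 - `|s| / 2)).
  move=> x; apply: continuous_comp; last exact: continuous_expR.
  apply: cvgB; first exact: cvg_cst.
  by apply: cvgMr_tmp; exact: norm_continuous.
apply/integrableP; split.
  by apply/measurable_EFinP; exact: continuous_measurable_fun.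
under eq_integral do rewrite /= ger0_norm ?expR_ge0//.
rewrite ge0_symfun_integralT//; last by move=> x /=; rewrite normrN.
rewrite -set_itvcy.
have dF (x : R) : is_derive x 1 (fun s : R => - 2 * expR (1 - s / 2)) (expR (1 - x / 2)).
  have d1 : is_derive x 1 (fun s : R => 1 - s / 2) (- 2^-1).
    have -> : (fun s : R => 1 - s / 2) = cst 1 - 2^-1 *: id.
      by apply/funext => s; rewrite fctE /= mulrC.
    have := is_deriveB (is_derive_cst (1 : R) x 1) (is_deriveZ (2^-1 : R) (is_derive_id x 1)).
    by rewrite sub0r -[_ *: 1]/(_ * 1) mulr1.
  have := is_deriveZ (- 2 : R) (@is_derive1_comp _ expR _ x _ _ (is_derive_expR (1 - x / 2)) d1).
  by rewrite -[_ *: (_ * _)]/(_ * (_ * _)) mulrN mulNr mulrN opprK mulrCA mulfV// mulr1.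
rewrite (@ge0_continuous_FTC2y _ _ (fun s : R => - 2 * expR (1 - s / 2)) 0 0).
- by rewrite -EFinB -EFinM ltry.
- by move=> x _; exact: expR_ge0.
- exact: continuous_subspaceT.
- rewrite -[X in _ --> X](mulr0 (- 2)); apply: cvgMl_tmp.
  have -> : (fun s : R => expR (1 - s / 2)) = (fun s => expR 1 * expR (- (s / 2))).
    by apply/funext => s; rewrite expRD.
  rewrite -[X in _ --> X](mulr0 (expR 1)); apply: cvgMl_tmp.
  apply: (@cvg_comp _ _ _ (fun s : R => s / 2) (fun s => expR (- s))); last exact: cvgr_expR.
  by apply: gt0_cvgMly => //; exact: cvg_id.
- by move=> x _; have [] := dF x.
- by apply: cvg_at_right_filter; exact: (is_derive_continuous (dF 0)).
- move=> x /[!in_itv]/= /andP[x0 _].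
  by rewrite derive1E; have [_ ->] := dF x; rewrite ger0_norm// ltW.
Qed.

Lemma truncated_shape_bounds m s : (0 < m)%N ->
  0 <= truncated_shape m s <= expR (1 - `|s| / 2).
Proof.
move=> m0; rewrite /truncated_shape; case: ifP => h; last by rewrite lexx expR_ge0.
rewrite poisson_shape_le// andbT mulr_ge0 ?expR_ge0// exprn_ge0//.
by rewrite -lerBlDl sub0r ler_pdivlMr ?sqrtr_gt0 ?ltr0n// mulN1r.
Qed.

Lemma integrable_truncated_shape m : (0 < m)%N ->
  lebesgue_measure.-integrable setT (EFin \o truncated_shape m).
Proof.
move=> m0; apply: le_integrable integrable_shape_bound => //.
  by apply/measurable_EFinP; exact: measurable_truncated_shape.
move=> s _ /=; rewrite lee_fin.
by case/andP: (truncated_shape_bounds s m0) => h1 h2; rewrite ger0_norm// [leRHS]ger0_norm ?expR_ge0.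
Qed.

Lemma cvg_integral_truncated_shape (D : set R) : measurable D ->
  (\int[lebesgue_measure]_(s in D) truncated_shape n.+1 s) @[n --> \oo] -->
   \int[lebesgue_measure]_(s in D) expR (- (s ^+ 2 / 2)).
Proof.
move=> mD.
have mf n : measurable_fun D (EFin \o truncated_shape n.+1).
  by apply/measurable_EFinP; apply: measurable_funTS; exact: measurable_truncated_shape.
have mg : measurable_fun D (EFin \o (fun s : R => expR (- (s ^+ 2 / 2)))).
  apply/measurable_EFinP; apply: measurable_funTS.
  apply: measurableT_comp => //; apply: measurableT_comp => //.
  by apply: measurable_funM => //; exact: measurable_funX.
have bound n s := @truncated_shape_bounds n.+1 s isT.
have [] := @dominated_convergence _ _ _ lebesgue_measure D mD
  (fun n => EFin \o truncated_shape n.+1) (EFin \o (fun s => expR (- (s ^+ 2 / 2))))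
  (EFin \o (fun s : R => expR (1 - `|s| / 2))) mf mg.
- apply: aeW => s _; apply/fine_cvgP; split; first exact: nearW.
  have h : poisson_shape n.+1 s @[n --> \oo] --> expR (- (s ^+ 2 / 2)).
    by rewrite (cvg_shiftS (poisson_shape ^~ s)); exact: cvg_poisson_shape.
  apply: cvg_trans h; apply: near_eq_cvg; near=> n.
  rewrite /= /truncated_shape ifT// lerNl.
  near: n; apply: (cvgry_ge _ (- s)).
  by rewrite (cvg_shiftS (fun n => Num.sqrt (n%:R : R))); exact: cvg_sqrt_natr.
- by apply: (integrableS measurableT) integrable_shape_bound.
- apply: aeW => s n _; rewrite /= lee_fin.
  by case/andP: (bound n s) => h1 h2; rewrite ger0_norm.
move=> ig _; have fin : (\int[lebesgue_measure]_(s in D)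
    (EFin \o (fun s => expR (- (s ^+ 2 / 2)))) s)%E \is a fin_num.
  exact: integrable_fin_num.
by rewrite -[X in _ --> X -> _](fineK fin) => /fine_cvg; exact.
Unshelve. all: by end_near. Qed.

(** The fundamental theorem of calculus in the mean, from x to infinity, where the distribution
    function vanishes. *)
Lemma poisson_cdf_integral m x : (0 < m)%N -> - Num.sqrt m%:R <= x ->
  (poisson_cdf (m%:R + x * Num.sqrt m%:R) m =
   poisson_peak m * \int[lebesgue_measure]_(s in `[x, +oo[) truncated_shape m s).
Proof.
move=> m0 mx.
pose F (s : R) := - poisson_cdf (m%:R + s * Num.sqrt m%:R) m.
have sm0 : 0 < Num.sqrt (m%:R : R) by rewrite sqrtr_gt0 ltr0n.
have dF (s : R) : is_derive s 1 F (poisson_peak m * poisson_shape m s).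
  by have := is_deriveN (is_derive_poisson_cdf_affine s m0); rewrite opprK.
have peak0 : 0 <= poisson_peak m.
  by rewrite /poisson_peak !mulr_ge0 ?sqrtr_ge0 ?expR_ge0 ?exprn_ge0// invr_ge0.
have shape0 (s : R) : x <= s -> 0 <= poisson_shape m s.
  move=> xs; rewrite mulr_ge0 ?expR_ge0// exprn_ge0//.
  by rewrite -lerBlDl sub0r ler_pdivlMr// mulN1r (le_trans mx).
have E : (\int[lebesgue_measure]_(s in `[x, +oo[)
    (poisson_peak m * poisson_shape m s)%:E = 0%:E - (F x)%:E)%E.
  apply: ge0_continuous_FTC2y.
  - by move=> s xs; rewrite mulr_ge0// shape0.
  - apply: continuous_subspaceT => s; apply: cvgMl_tmp; exact: continuous_poisson_shape.
  - rewrite -oppr0; apply: cvgN.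
    apply: (@cvg_comp _ _ _ (fun s => m%:R + s * Num.sqrt m%:R) (fun l => poisson_cdf l m)); last exact: cvg_poisson_cdf.
    apply/cvgryPge => A; near=> s; by rewrite -lerBlDl -ler_pdivrMr.
  - by move=> s _; have [] := dF s.
  - apply: cvg_at_right_filter; exact: (is_derive_continuous (dF x)).
  - by move=> s _; rewrite derive1E; have [_ ->] := dF s.
have E2 : (poisson_cdf (m%:R + x * Num.sqrt m%:R) m =
  \int[lebesgue_measure]_(s in `[x, +oo[) (poisson_peak m * poisson_shape m s)).
  by rewrite /Rintegral E /F EFinN sub0e oppeK.
rewrite E2 -RintegralZl//.
- apply: eq_Rintegral => s; rewrite inE/= in_itv/= andbT => xs.
  by rewrite /truncated_shape ifT// (le_trans mx).
- exact: (integrableS measurableT _ _ (integrable_truncated_shape m0)).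
Unshelve. all: by end_near. Qed.

Lemma Rintegral_gauss :
  \int[lebesgue_measure]_(s in setT) expR (- (s ^+ 2 / 2)) = Num.sqrt (2 * pi) :> R.
Proof.
have peak : @normal_peak R 1 = (Num.sqrt (2 * pi))^-1.
  by rewrite /normal_peak expr1n mul1r mulr_natl.
have sq0 : Num.sqrt (2 * pi) != 0 :> R.
  by rewrite gt_eqF// sqrtr_gt0 mulr_gt0// pi_gt0.
have : (\int[lebesgue_measure]_(s in setT) (normal_pdf 0 1 s)%:E)%E = 1%:E :> \bar R.
  exact: integral_normal_pdf.
have -> : (\int[lebesgue_measure]_(s in setT) (normal_pdf 0 1 s)%:E)%E =
  ((Num.sqrt (2 * pi))^-1%:E *
   \int[lebesgue_measure]_(s in setT) (expR (- (s ^+ 2 / 2)))%:E)%E :> \bar R.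
  rewrite -ge0_integralZl_EFin ?invr_ge0 ?sqrtr_ge0//; last first.
    apply/measurable_EFinP; apply: measurableT_comp => //; apply: measurableT_comp => //.
    by apply: measurable_funM => //; exact: measurable_funX.
  apply: eq_integral => s _; rewrite normal_pdfE ?oner_eq0// /= peak.
  by rewrite /normal_fun subr0 expr1n mulNr.
move/(congr1 fine); rewrite /Rintegral.
(* [fine] sends both infinities to 0, so an infinite integral would yield 0 = 1. *)
case: (\int[lebesgue_measure]_(s in setT) _)%E => [r||] /=.
- by move=> /(congr1 ( *%R (Num.sqrt (2 * pi)))); rewrite mulVKf// mulr1.
- by rewrite gt0_muley ?lte_fin ?invr_gt0 ?lt0r ?sq0 ?sqrtr_ge0// => /esym/eqP; rewrite oner_eq0.
- by rewrite gt0_muleNy ?lte_fin ?invr_gt0 ?lt0r ?sq0 ?sqrtr_ge0// => /esym/eqP; rewrite oner_eq0.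
Qed.

Lemma Phi_itvcy z : Phi z =
  (\int[lebesgue_measure]_(s in `[- z, +oo[) expR (- (s ^+ 2 / 2))) / Num.sqrt (2 * pi) :> R.
Proof.
rewrite /Phi div1r mulrC; congr (_ / _).
rewrite /Rintegral -{1}[z]opprK ge0_integration_by_substitutionNy.
- by congr fine; apply: eq_integral => s _ /=; rewrite sqrrN.
- apply: continuous_subspaceT => s; apply: continuous_comp; last exact: continuous_expR.
  by apply: cvgN; apply: cvgMr_tmp; exact: exprn_continuous.
- by move=> s _; exact: expR_ge0.
Qed.

(** At x = - sqrt m the mean is 0 and the distribution function is 1, so the peak is the inverse of
    the total integral of the truncated shape. The distribution function is then a quotient of two
    integrals, each of which converges. *)
Lemma cvg_poisson_cdf_affine x :
  poisson_cdf (n.+1%:R + x * Num.sqrt n.+1%:R) n.+1 @[n --> \oo] --> Phi (- x).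
Proof.
pose I n : R := \int[lebesgue_measure]_(s in setT) truncated_shape n.+1 s.
pose J n : R := \int[lebesgue_measure]_(s in `[x, +oo[) truncated_shape n.+1 s.
have E n : - Num.sqrt n.+1%:R <= x ->
    poisson_cdf (n.+1%:R + x * Num.sqrt n.+1%:R) n.+1 = J n / I n.
  move=> mx.
  have h1 := poisson_cdf_integral (ltn0Sn n) mx.
  have := poisson_cdf_integral (ltn0Sn n) (lexx _).
  rewrite mulNr -expr2 sqr_sqrtr// subrr poisson_cdf0.
  rewrite Rintegral_mkcond (_ : _ \_ _ = truncated_shape n.+1); last first.
    apply/funext => s; rewrite patchE; case: ifPn => //.
    rewrite notin_setE/= in_itv/= andbT => /negP; rewrite -ltNge => h.
    by rewrite /truncated_shape ifF//; apply/negbTE; rewrite -ltNge.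
  rewrite -/(I n) h1 -/(J n) => /esym h.
  have I0 : I n != 0.
    by apply/eqP => I0; move: h; rewrite I0 mulr0 => /eqP; rewrite eq_sym oner_eq0.
  by rewrite -[LHS](mulfK I0) [_ * I n]mulrAC h mul1r.
have -> : Phi (- x) = (\int[lebesgue_measure]_(s in `[x, +oo[) expR (- (s ^+ 2 / 2))) /
   (\int[lebesgue_measure]_(s in setT) expR (- (s ^+ 2 / 2))) :> R.
  by rewrite Phi_itvcy opprK Rintegral_gauss.
apply: (@cvg_trans _ (J n / I n @[n --> \oo])).
  apply: near_eq_cvg; near=> n.
  rewrite E// lerNl; near: n; apply: (cvgry_ge _ (- x)).
  by rewrite (cvg_shiftS (fun n => Num.sqrt (n%:R : R))); exact: cvg_sqrt_natr.
apply: cvgM; first exact: cvg_integral_truncated_shape.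
apply: cvgV; last exact: cvg_integral_truncated_shape.
by rewrite Rintegral_gauss gt_eqF// sqrtr_gt0 mulr_gt0// pi_gt0.
Unshelve. all: by end_near. Qed.

Lemma poisson_cdf_nincr m l1 l2 : 0 <= l1 -> l1 <= l2 ->
  poisson_cdf l2 m <= poisson_cdf l1 m.
Proof.
move=> l10 l12; have [||c /[!in_itv]/= /andP[c1 c2] E] := @MVT_segment _ (poisson_cdf ^~ m)
    (fun l => - (expR (- l) * (l ^+ m / m`!%:R))) _ _ l12.
- by move=> l _; exact: is_derive_poisson_cdf.
- apply: continuous_subspaceT => l.
  exact: (is_derive_continuous (is_derive_poisson_cdf m l)).
rewrite -subr_le0 E mulNr oppr_le0 !mulr_ge0 ?expR_ge0 ?invr_ge0 ?exprn_ge0 ?subr_ge0//.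
exact: (le_trans l10).
Qed.

Lemma Phi_lipschitz x y : x <= y -> 0 <= Phi y - Phi x <= y - x.
Proof.
move=> xy; have ig : lebesgue_measure.-integrable setT (EFin \o (fun s : R => expR (- (s ^+ 2 / 2)))).
  apply: le_integrable integrable_shape_bound => //.
    apply/measurable_EFinP; apply: measurableT_comp => //; apply: measurableT_comp => //.
    by apply: measurable_funM => //; exact: measurable_funX.
  move=> s _ /=; rewrite lee_fin ger0_norm ?expR_ge0// ger0_norm ?expR_ge0// ler_expR.
  by have := sqr_ge0 (`|s| - 2^-1); rewrite -[s ^+ 2]real_normK ?num_real//; have := sqr_ge0 (`|s|); nra.
have mE : lebesgue_measure (`]x, y]%classic : set R) = (y - x)%:E.
  rewrite lebesgue_measure_itv/= lte_fin; case: ltP => h; first by rewrite EFinB.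
  by congr EFin; apply/eqP; rewrite eq_sym subr_eq0 eq_le h xy.
rewrite /Phi -mulrBr Rintegral_itvB ?bnd_simp//; last exact: integrableS ig.
have sq1 : 1 <= Num.sqrt (2 * pi) :> R.
  by rewrite -[leLHS]sqrtr1 ler_wsqrtr//; have := pi_ge2 R; lra.
set I := Rintegral _ _ _.
have I0 : 0 <= I by apply: Rintegral_ge0 => s _; exact: expR_ge0.
have I1 : I <= y - x.
  rewrite (_ : y - x = \int[lebesgue_measure]_(s in `]x, y]) 1).
    apply: le_Rintegral => //; first exact: integrableS ig.
      apply: measurable_bounded_integrable => //.
        by apply: (@eq_ind _ _ (fun u => u < +oo)%E (ltry (y - x)%R) _ (esym mE)).
      by exists 1; split; [exact: num_real|move=> M M1 s _ /=; rewrite normr1 ltW].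
    by move=> s _; rewrite -expR0 ler_expR oppr_le0 divr_ge0// sqr_ge0.
  by rewrite Rintegral_cst//= mE mul1r.
rewrite div1r mulr_ge0 ?invr_ge0 ?sqrtr_ge0//=.
rewrite mulrC ler_pdivrMr ?(lt_le_trans _ sq1)//; nra.
Qed.

(** Eventually [lam N] lies between m + (- z - d) sqrt m and m + (- z + d) sqrt m. Monotonicity in
    the mean and the Lipschitz bound on [Phi] reduce to the affine case at these two ends. *)
Lemma cvg_poisson_normal (lam : nat -> R) (m : nat -> nat) (z : R) :
    (forall N, 0 <= lam N) ->
    m @ \oo --> \oo ->
    ((m N)%:R - lam N) / Num.sqrt (m N)%:R @[N --> \oo] --> z ->
  poisson_cdf (lam N) (m N) @[N --> \oo] --> Phi z.
Proof.
move=> lam0 moo mz.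
have lim x : poisson_cdf ((m N)%:R + x * Num.sqrt (m N)%:R) (m N) @[N --> \oo] --> Phi (- x).
  apply: (@cvg_comp _ _ _ m (fun n => poisson_cdf (n%:R + x * Num.sqrt n%:R) n) _ _ _ moo).
  by rewrite -(cvg_shiftS (fun n => poisson_cdf (n%:R + x * Num.sqrt n%:R) n)); exact: cvg_poisson_cdf_affine.
apply/cvgrPdist_le => eps eps0.
have [d d0 ed] : exists2 d, 0 < d & eps = d + d.
  by exists (eps / 2); [rewrite divr_gt0|field].
near=> N.
have m0 : (0 < m N)%N by near: N; exact: (moo _ (nbhs_infty_gt 0)).
have sm0 : 0 < Num.sqrt ((m N)%:R : R) by rewrite sqrtr_gt0 ltr0n.
have : `|z - ((m N)%:R - lam N) / Num.sqrt (m N)%:R| <= d.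
  by near: N; exact: cvgr_dist_le mz _ d0.
rewrite ler_norml => /andP[h1 h2].
have l1 : lam N <= (m N)%:R + (- z + d) * Num.sqrt (m N)%:R.
  have : z - d <= ((m N)%:R - lam N) / Num.sqrt (m N)%:R by lra.
  by rewrite ler_pdivlMr//; lra.
have l2 : (m N)%:R + (- z - d) * Num.sqrt (m N)%:R <= lam N.
  have : ((m N)%:R - lam N) / Num.sqrt (m N)%:R <= z + d by lra.
  by rewrite ler_pdivrMr//; lra.
have u1 : `|Phi (- (- z + d)) - poisson_cdf ((m N)%:R + (- z + d) * Num.sqrt (m N)%:R) (m N)| <= d.
  by near: N; exact: cvgr_dist_le (lim _) _ d0.
have u2 : `|Phi (- (- z - d)) - poisson_cdf ((m N)%:R + (- z - d) * Num.sqrt (m N)%:R) (m N)| <= d.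
  by near: N; exact: cvgr_dist_le (lim _) _ d0.
have l0 : 0 <= (m N)%:R + (- z - d) * Num.sqrt (m N)%:R.
  have h : z + d <= Num.sqrt ((m N)%:R : R).
    near: N; apply: (cvgry_ge (@cvg_comp _ _ _ m (fun n => Num.sqrt (n%:R : R)) _ _ _ moo _)).
    exact: cvg_sqrt_natr.
  by rewrite -{1}[(m N)%:R]sqr_sqrtr//; nra.
have v1 := poisson_cdf_nincr (m N) (lam0 N) l1.
have v2 := poisson_cdf_nincr (m N) l0 l2.
have w1 : - (- z + d) <= z by lra.
have w2 : z <= - (- z - d) by lra.
have {w1}/andP[_ w1] := Phi_lipschitz w1.
have {w2}/andP[_ w2] := Phi_lipschitz w2.
move: u1 u2; rewrite !ler_norml => /andP[u1 u1'] /andP[u2 u2'].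
by apply/andP; split; lra.
Unshelve. all: by end_near. Qed.

End PoissonLimit.

(** * Mertens' theorems *)

Section Mertens.

Lemma coprime_prod_primes p (s : seq nat) : prime p -> all prime s -> p \notin s ->
  coprime p (\prod_(q <- s) q).
Proof.
move=> pp ap ps; rewrite prime_coprime// Euclid_dvd_prod// big_has; apply/hasPn => q qs.
rewrite dvdn_prime2//; last exact: (allP ap).
by apply: contraNneq ps => ->.
Qed.

Lemma prod_primes_dvdn (s : seq nat) d : uniq s -> all prime s ->
  (\prod_(p <- s) p %| d)%N = all (dvdn^~ d) s.
Proof.
elim: s => [|p s IH] /=; first by rewrite big_nil dvd1n.
move=> /andP[ps us] /andP[pp ap].
by rewrite big_cons Gauss_dvd ?IH// coprime_prod_primes.
Qed.

Lemma bin_le_exp2 n k : ('C(n, k) <= 2 ^ n)%N.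
Proof.
have [kn|kn] := leqP k n; last by rewrite bin_small.
have := Pascal 1 1 n; rewrite addn1 => ->.
rewrite (bigD1 (Ordinal (leq_ltn_trans kn (ltnSn n))))//= !exp1n !muln1.
exact: leq_addr.
Qed.

Lemma prime_dvdn_fact p m : prime p -> (p %| m`!)%N -> (p <= m)%N.
Proof.
move=> pp; elim: m => [|m IH]; first by rewrite dvdn1; case: p pp => [|[]].
by rewrite factS Euclid_dvdM// => /orP[/dvdn_leq ->//|/IH /leqW].
Qed.

Lemma fact_le_expn n : (n`! <= n ^ n)%N.
Proof.
elim: n => // n IH; rewrite factS expnS leq_mul2l /=.
apply: (leq_trans IH); case: n {IH} => // n; by rewrite leq_exp2r.
Qed.

(** The primes in (m, 2m] divide the binomial coefficient of 2m over m, which is at most 2^(2m). *)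
Lemma primorial_double m :
  (\prod_(0 <= p < m.*2.+1 | prime p) p <=
   (\prod_(0 <= p < m.+1 | prime p) p) * 2 ^ m.*2)%N.
Proof.
rewrite (@big_cat_nat _ _ _ m.+1)//=; last by rewrite ltnS -addnn leq_addr.
rewrite leq_mul2l; apply/orP; right.
apply: leq_trans (bin_le_exp2 m.*2 m).
apply: dvdn_leq; first by rewrite bin_gt0 -addnn leq_addr.
rewrite -big_filter prod_primes_dvdn ?filter_uniq ?iota_uniq ?filter_all//.
apply/allP => p; rewrite mem_filter mem_index_iota => /andP[pp /andP[mp pm]].
have : (p %| m.*2`!)%N by rewrite dvdn_fact// prime_gt0//.
rewrite -(bin_fact (m := m) (n := m.*2)) -?addnn ?leq_addr// addnK.
rewrite !Euclid_dvdM// => /or3P[//||].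
all: by move=> /(prime_dvdn_fact pp); rewrite leqNgt mp.
Qed.

(** With m = n/2 rounded up, induction and doubling give 2^(4m + 2m), and 6m <= 4n once n >= 3. The
    base 16 = 2^4 leaves room for the rounding. *)
Lemma primorial_le n : (\prod_(0 <= p < n.+1 | prime p) p <= 16 ^ n)%N.
Proof.
have [k] := ubnP n; elim: k n => // k IH n nk.
have [n2|n2] := leqP n 2.
  by case: n nk n2 => [|[|[|]]]// _ _; rewrite unlock.
set m := n.+1./2.
have mn : (n <= m.*2 <= n.+1)%N by rewrite /m; lia.
apply: (@leq_trans (\prod_(0 <= p < m.*2.+1 | prime p) p)).
  rewrite [leqRHS](@big_cat_nat _ _ _ n.+1)//=; last by case/andP: mn.
  rewrite leq_pmulr// prodn_cond_gt0// => p; exact: prime_gt0.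
apply: (leq_trans (primorial_double m)).
have h := IH m _.
apply: (leq_trans (leq_mul (h _) (leqnn _))); first by lia.
rewrite -[16%N]/(2 ^ 4)%N -!expnM -expnD leq_exp2l//; lia.
Qed.

Context {R : realType}.

Lemma ln_prod (I : Type) (r : seq I) (P : pred I) (F : I -> R) :
  (forall i, P i -> 0 < F i) ->
  ln (\prod_(i <- r | P i) F i) = \sum_(i <- r | P i) ln (F i).
Proof.
move=> F0; elim: r => [|i r IH]; first by rewrite !big_nil ln1.
rewrite !big_cons; case: ifPn => // Pi.
by rewrite lnM ?IH// posrE ?F0// prodr_gt0.
Qed.

Lemma chebyshev_theta_le n :
  \sum_(0 <= p < n.+1 | prime p) ln (p%:R : R) <= n%:R * ln 16.
Proof.
have prime_gt0R p : prime p -> 0 < (p%:R : R) by rewrite ltr0n; exact: prime_gt0.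
rewrite -ln_prod// -natr_prod mulr_natl -lnXn// -natrX.
rewrite ler_ln ?posrE ?ltr0n ?expn_gt0 ?prodn_cond_gt0 ?ler_nat ?primorial_le//.
by move=> p; exact: prime_gt0.
Qed.

(** Legendre's formula. The factorization is first written over all p <= n!; primes above n do not
    divide n!. *)
Lemma ln_fact_primes n : ln (n`!%:R : R) =
  \sum_(0 <= p < n.+1 | prime p) (\sum_(1 <= k < n.+1) n %/ p ^ k)%:R * ln p%:R.
Proof.
have prime_gt0R p : prime p -> 0 < (p%:R : R) by rewrite ltr0n; exact: prime_gt0.
have nle : (n <= n`!)%N by elim: n => // n IH; rewrite factS; have := fact_gt0 n; nia.
have {1}-> : n`! = (\prod_(0 <= p < n`!.+1 | prime p) p ^ logn p n`!)%N.
  rewrite -{1}[n`!](partnT (fact_gt0 n)) /partn big_mkcond [RHS]big_mkcond /=.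
  apply: eq_bigr => p _; case: ifPn => // pp.
  by rewrite lognE (negbTE pp).
rewrite natr_prod ln_prod; last by move=> p pp; rewrite ltr0n expn_gt0 prime_gt0.
rewrite (@big_cat_nat _ _ _ n.+1)//= [X in _ + X]big_nat_cond [X in _ + X]big1 ?addr0.
  apply: eq_bigr => p pp; rewrite natrX lnXn ?prime_gt0R// logn_fact//.
  by rewrite mulr_natl.
move=> p /andP[/andP[np _] pp]; rewrite lognE.
case: ifP => [/and3P[_ _ /(prime_dvdn_fact pp)]|_]; first by rewrite leqNgt np.
by rewrite expn0 ln1.
Qed.

Lemma ln_fact_ge n : (0 < n)%N -> n%:R * ln n%:R - n%:R <= ln (n`!%:R : R).
Proof.
move=> n0.
have h := expR_ge1Dxn n.-1 (ler0n R n); rewrite prednK// in h.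
have f0 : 0 < n`!%:R :> R by rewrite ltr0n fact_gt0.
have nR0 : 0 < n%:R :> R by rewrite ltr0n.
have {}h : n%:R ^+ n / n`!%:R <= expR (n%:R : R) by apply: le_trans h; rewrite lerDr.
rewrite lerBlDr -lerBlDl -ler_expR expRB expRM_natl !lnK ?posrE//.
Qed.

Lemma ln_le_sub1 (x : R) : 0 < x -> ln x <= x - 1.
Proof.
move=> x0; rewrite -{1}[x](subrKC 1).
by apply: le_ln1Dx; rewrite -subr_gt0 opprK subrK.
Qed.

Lemma ln_le_sqrt_pred n : (0 < n)%N -> ln (n.+1%:R : R) <= 2 * Num.sqrt n%:R.
Proof.
move=> n0; set t : R := Num.sqrt n.+1%:R.
have t0 : 0 < t by rewrite sqrtr_gt0.
have -> : n.+1%:R = t ^+ 2 by rewrite sqr_sqrtr.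
rewrite lnXn// -[_ *+ 2]mulr_natl ler_pM2l//.
apply: (le_trans (ln_le_sub1 t0)); rewrite lerBlDr /t.
rewrite -(@ler_sqr _ _ (_ + 1)) ?nnegrE ?sqrtr_ge0 ?addr_ge0 ?sqrtr_ge0//.
rewrite sqr_sqrtr// sqrrD1 sqr_sqrtr// -natr1.
by rewrite [leRHS]addrAC lerDl mulrn_wge0 ?sqrtr_ge0.
Qed.

(** Comparison with the telescoping 4 - 4 / sqrt n. For consecutive roots s < t of n+1 and n+2, t -
    s = 1 / (s + t) >= 1 / (2t), so the increment 4 (t - s) / (s t) covers the term, whose logarithm
    is at most 2 s. *)
Lemma sum_ln_div_mul_pred_le n :
  \sum_(0 <= p < n.+1 | prime p) ln (p%:R : R) / (p%:R * (p%:R - 1)) <= 4.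
Proof.
suff h : (0 < n)%N -> \sum_(0 <= p < n.+1 | prime p) ln (p%:R : R) / (p%:R * (p%:R - 1)) <=
    4 - 4 / Num.sqrt n%:R.
  have [n0|n0] := posnP n; first by rewrite n0 big_mkcond big_nat1.
  by apply: le_trans (h n0) _; rewrite lerBlDr lerDl divr_ge0 ?sqrtr_ge0.
case: n => // n _; elim: n => [|n IH].
  by rewrite big_mkcond big_nat_recr//= big_nat1 addr0 sqrtr1 divr1 subrr.
rewrite big_mkcond big_nat_recr//= -big_mkcond /=.
have -> : 4 - 4 / Num.sqrt n.+2%:R = (4 - 4 / Num.sqrt n.+1%:R) +
  (4 / Num.sqrt n.+1%:R - 4 / Num.sqrt n.+2%:R) :> R by rewrite addrA subrK.
apply: lerD => //.
have := @ln_le_sqrt_pred n.+1 isT.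
have s1 : 0 < Num.sqrt n.+1%:R :> R by rewrite sqrtr_gt0.
have s12 : Num.sqrt n.+1%:R <= Num.sqrt n.+2%:R :> R by rewrite ler_wsqrtr// ler_nat.
have e1 : Num.sqrt n.+1%:R ^+ 2 = n.+2%:R - 1 :> R by rewrite sqr_sqrtr// -[n.+2%:R]natr1 addrK.
have e2 : Num.sqrt n.+2%:R ^+ 2 = n.+2%:R :> R by rewrite sqr_sqrtr.
move: (Num.sqrt n.+1%:R) (Num.sqrt n.+2%:R) s1 s12 e1 e2 => s t s1 st e1 e2 h.
have t0 : 0 < t by exact: lt_le_trans st.
case: ifP => _; last by rewrite subr_ge0 ler_pM2l// lef_pV2.
apply: (@le_trans _ _ (2 * s / (n.+2%:R * (n.+2%:R - 1)))).
  by rewrite ler_wpM2r// invr_ge0 mulr_ge0// -e1 sqr_ge0.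
rewrite -e1 -e2.
have -> : 4 / s - 4 / t = 4 * (t - s) / (s * t) by field; rewrite !gt_eqF.
have -> : 2 * s / (t ^+ 2 * s ^+ 2) = 2 / t * (s * t)^-1 by field; rewrite !gt_eqF.
rewrite ler_wpM2r ?invr_ge0 ?mulr_ge0 ?(ltW t0) ?(ltW s1)//.
rewrite ler_pdivrMr//.
have : (t - s) * (t + s) = 1 by rewrite -subr_sqr e1 e2 opprB addrCA subrr addr0.
nra.
Qed.

Lemma sum_inv_exp_le p n : (1 < p)%N ->
  \sum_(1 <= k < n.+1) (p%:R ^+ k)^-1 <= (p%:R - 1)^-1 :> R.
Proof.
move=> p1; have p1R : 1 < p%:R :> R by rewrite ltr1n.
suff : \sum_(1 <= k < n.+1) (p%:R ^+ k)^-1 = (p%:R - 1)^-1 * (1 - (p%:R ^+ n)^-1) :> R.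
  by move=> ->; rewrite ler_piMr ?invr_ge0 ?subr_ge0 ?(ltW p1R)//.
elim: n => [|n IH]; first by rewrite big_nil expr0 invr1 subrr mulr0.
rewrite big_nat_recr//= IH exprS.
have pn : p%:R ^+ n != 0 :> R by rewrite expf_neq0 ?gt_eqF// (lt_trans _ p1R).
by field; rewrite pn subr_eq0 (gt_eqF p1R) (gt_eqF (lt_trans _ p1R)).
Qed.

Lemma natr_divn_le n d : (n %/ d)%:R <= n%:R / d%:R :> R.
Proof.
have [->|d0] := posnP d; first by rewrite divn0 invr0 mulr0.
by rewrite ler_pdivlMr ?ltr0n// -natrM ler_nat leq_trunc_div.
Qed.

Lemma natr_divn_ge n d : (0 < d)%N -> n%:R / d%:R - 1 <= (n %/ d)%:R :> R.
Proof.
move=> d0; rewrite lerBlDr ler_pdivrMr ?ltr0n// natr1 -natrM ler_nat.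
by rewrite ltnW// ltn_ceil.
Qed.

(** Legendre's formula for ln n! is compared with n ln n. From above, dropping the floors in n / p
    costs at most n ln 16 <= 4n by Chebyshev. From below, the higher prime powers cost at most 4n
    and ln n! >= n ln n - n; hence 5 = 4 + 1. *)
Lemma mertens_first n : (0 < n)%N ->
  `|\sum_(0 <= p < n.+1 | prime p) ln (p%:R : R) / p%:R - ln n%:R| <= 5.
Proof.
move=> n0; have nR0 : 0 < n%:R :> R by rewrite ltr0n.
set S := \sum_(_ <= p < _ | _) _.
have lnp0 p : prime p -> 0 <= ln (p%:R : R).
  by move=> pp; rewrite ln_ge0// ler1n prime_gt0.
have up : n%:R * S <= n%:R * (ln n%:R + 4).
  apply: (@le_trans _ _ (ln (n`!%:R : R) + \sum_(0 <= p < n.+1 | prime p) ln (p%:R : R))).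
    rewrite ln_fact_primes -big_split/= mulr_sumr ler_sum// => p pp.
    rewrite -[X in _ + X]mul1r -mulrDl mulrCA mulrC ler_wpM2r ?lnp0//.
    rewrite -lerBlDr (le_trans (natr_divn_ge n (prime_gt0 pp)))// ler_nat.
    by rewrite big_ltn// expn1 leq_addr.
  rewrite mulrDr; apply: lerD.
    rewrite mulr_natl -lnXn// ler_ln ?posrE ?ltr0n ?fact_gt0 ?exprn_gt0//.
    by rewrite -natrX ler_nat fact_le_expn.
  apply: (le_trans (chebyshev_theta_le n)); rewrite ler_wpM2l//.
  have -> : 16 = 2 ^+ 4 :> R by rewrite -natrX.
  rewrite lnXn// -[_ *+ 4]mulr_natl -[leRHS]mulr1 ler_wpM2l//.
  by rewrite (le_trans (le_ln1Dx (_ : -1 < 1)))//; lra.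
have low : n%:R * (ln n%:R - 1) <= n%:R * (S + 4).
  rewrite mulrBr mulr1; apply: (le_trans (ln_fact_ge n0)).
  rewrite ln_fact_primes.
  apply: (@le_trans _ _ (n%:R * (S + \sum_(0 <= p < n.+1 | prime p) ln (p%:R : R) / (p%:R * (p%:R - 1))))); last first.
    by rewrite ler_wpM2l// lerD2l sum_ln_div_mul_pred_le.
  rewrite -big_split /= mulr_sumr ler_sum// => p pp.
  have p1 : 1 < p%:R :> R by rewrite ltr1n prime_gt1.
  have p0 := lt_trans ltr01 p1.
  have -> : n%:R * (ln p%:R / p%:R + ln p%:R / (p%:R * (p%:R - 1))) =
     n%:R * (p%:R - 1)^-1 * ln p%:R :> R.
    by field; rewrite subr_eq0 !gt_eqF.
  rewrite ler_wpM2r ?lnp0// natr_sum.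
  apply: (@le_trans _ _ (n%:R * \sum_(1 <= k < n.+1) (p%:R ^+ k)^-1)).
    rewrite mulr_sumr ler_sum// => k _; rewrite -natrX; exact: natr_divn_le.
  by rewrite ler_wpM2l// sum_inv_exp_le// prime_gt1.
move: up low; rewrite !ler_pM2l// => up low.
by rewrite ler_norml; apply/andP; split; lra.
Qed.

Definition prime_recip_sum n : R := \sum_(0 <= p < n.+1 | prime p) p%:R^-1.

(* Abel summation: with E n the error term of Mertens' first theorem, the
   quantity D n below has increments at most 6 (1 / ln n - 1 / ln n.+1). *)
Lemma mertens_second : exists C : R, 0 < C /\
  forall n, (1 < n)%N -> `|prime_recip_sum n - ln (ln n%:R)| <= C.
Proof.
pose E n : R := \sum_(0 <= p < n.+1 | prime p) ln (p%:R : R) / p%:R - ln n%:R.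
pose D n : R := prime_recip_sum n - ln (ln n%:R) - E n / ln n%:R.
have lnn n : (1 < n)%N -> 0 < ln (n%:R : R) by move=> n1; rewrite ln_gt0// ltr1n.
have step n : (1 < n)%N -> `|D n.+1 - D n| <= 6 * ((ln n%:R)^-1 - (ln n.+1%:R)^-1).
  move=> n1.
  have l0 := lnn _ n1; have l1 := lnn _ (ltnW n1 : 1 < n.+1)%N.
  have ES : E n.+1 = E n + (ln n%:R - ln n.+1%:R) +
      (if prime n.+1 then ln n.+1%:R / n.+1%:R else 0).
    by rewrite /E big_mkcond big_nat_recr//= -big_mkcond /=; ring.
  have PS : prime_recip_sum n.+1 = prime_recip_sum n +
      (if prime n.+1 then n.+1%:R^-1 else 0).
    by rewrite /prime_recip_sum big_mkcond big_nat_recr//= -big_mkcond.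
  have ll : ln n%:R <= ln n.+1%:R :> R by rewrite ler_ln ?posrE ?ltr0n ?ler_nat// ltnW.
  have l1n : ln n.+1%:R - ln n%:R <= 1 :> R.
    have n0 : 0 < n%:R :> R by rewrite ltr0n ltnW.
    rewrite -ln_div ?posrE//.
    apply: le_trans (ln_le_sub1 _) _; first by rewrite divr_gt0.
    by rewrite -natr1 mulrDl divff ?gt_eqF// addrC addKr div1r invf_le1// ler1n ltnW.
  have En : `|E n| <= 5 by apply: mertens_first; exact: ltnW.
  have ub : ln (ln n.+1%:R) - ln (ln n%:R) <= (ln n.+1%:R - ln n%:R) / ln n%:R :> R.
    rewrite -ln_div ?posrE//.
    apply: le_trans (ln_le_sub1 _) _; first by rewrite divr_gt0.
    by rewrite mulrBl divff ?gt_eqF.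
  have lb : (ln n.+1%:R - ln n%:R) / ln n.+1%:R <= ln (ln n.+1%:R) - ln (ln n%:R) :> R.
    rewrite -lerN2 opprB -mulNr opprB -[leLHS]ln_div ?posrE//.
    apply: le_trans (ln_le_sub1 _) _; first by rewrite divr_gt0.
    by rewrite mulrBl divff ?gt_eqF.
  (* As ln (n+1) - ln n <= 1, the first difference is at most the last factor in absolute value;
     [E n] contributes 5 times that factor, hence the 6. *)
  have -> : D n.+1 - D n = (ln n.+1%:R - ln n%:R) / ln n.+1%:R -
     (ln (ln n.+1%:R) - ln (ln n%:R)) + E n * ((ln n%:R)^-1 - (ln n.+1%:R)^-1).
    rewrite /D ES PS; case: ifP => _; field; rewrite !gt_eqF//.
  have d0 : 0 <= (ln n%:R)^-1 - (ln n.+1%:R)^-1 :> R by rewrite subr_ge0 lef_pV2.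
  move: d0 ub lb; set u := (ln n%:R)^-1; set v := (ln n.+1%:R)^-1 => d0 ub lb.
  move: En; rewrite ler_norml => /andP[En1 En2].
  set x := ln n.+1%:R - ln n%:R in l1n ub lb *.
  have x0 : 0 <= x by rewrite subr_ge0.
  by rewrite ler_norml; apply/andP; split; nra.
have tele n : (1 < n)%N -> `|D n - D 2| <= 6 * ((ln 2%:R)^-1 - (ln n%:R)^-1).
  elim: n => // n IH; rewrite ltnS leq_eqVlt => /predU1P[<-|n1].
    by rewrite !subrr normr0 mulr0.
  have -> : D n.+1 - D 2 = (D n.+1 - D n) + (D n - D 2) by rewrite addrA subrK.
  apply: (le_trans (ler_normD _ _)).
  by have := step n n1; have := IH n1; lra.
have l2 := lnn 2%N isT.
exists (11 * (ln 2%:R)^-1 + `|D 2|); split.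
  by rewrite ltr_pwDl// mulr_gt0// invr_gt0.
move=> n n1; have l0 := lnn n n1.
have -> : prime_recip_sum n - ln (ln n%:R) = (D n - D 2) + D 2 + E n / ln n%:R.
  by rewrite /D; ring.
apply: (le_trans (ler_normD _ _)).
have h1 := ler_normD (D n - D 2) (D 2); have h2 := tele n n1.
have h3 : `|E n / ln n%:R| <= 5 * (ln n%:R)^-1.
  by rewrite normrM (gtr0_norm (_ : 0 < _^-1)) ?invr_gt0// ler_wpM2r ?invr_ge0 ?(ltW l0)// mertens_first// ltnW.
have h4 : (ln n%:R)^-1 <= (ln 2%:R)^-1 :> R.
  by rewrite lef_pV2 ?posrE// ler_ln ?posrE ?ltr0n ?ler_nat// ltnW.
have h5 : 0 <= (ln n%:R)^-1 :> R by rewrite invr_ge0 ltW.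
by move: h1 h2 h3 h4 h5; lra.
Qed.

End Mertens.

(** * Poisson approximation of prime factor counts *)

Section PoissonApproximation.
Context {R : realType}.

(** The coefficients that expand the indicator of w <= m in the binomials 'C(w, r). They turn a
    distribution function into a linear combination of binomial moments. *)
Definition poisson_coef m r : R := \sum_(k < m.+1) (-1) ^+ (r + k) * 'C(r, k)%:R.

(** Binomial inversion, by Pascal's rule. Terms with r > w vanish, so K may be any larger bound: one
    K serves all integers n, and can later tend to infinity. *)
Lemma sum_bin_bin_sign w k K : (w < K)%N ->
  \sum_(r < K) 'C(w, r)%:R * ((-1) ^+ (r + k) * 'C(r, k)%:R) = (w == k)%:R :> R.
Proof.
have shift w' k' K' : (w' < K')%N ->
    \sum_(r < K') 'C(w', r)%:R * ((-1) ^+ (r + k') * 'C(r, k')%:R) =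
    \sum_(r < w'.+1) 'C(w', r)%:R * ((-1) ^+ (r + k') * 'C(r, k')%:R) :> R.
  move=> wK; rewrite -!(big_mkord xpredT (fun r => 'C(w', r)%:R * ((-1) ^+ (r + k') * 'C(r, k')%:R))).
  rewrite (@big_cat_nat _ _ _ w'.+1)//= [X in _ + X]big_nat_cond [X in _ + X]big1 ?addr0//.
  by move=> r /andP[/andP[wr _] _]; rewrite bin_small// mul0r.
move=> wK; rewrite shift//; elim: w k {wK} => [|w IH] k.
  by rewrite big_ord1 bin0 mul1r add0n; case: k => [|k]; rewrite ?bin0 ?expr0 ?mul1r// mulr0.
rewrite big_ord_recl /=.
under eq_bigr do rewrite binS natrD mulrDl.
rewrite big_split /=.
have -> : \sum_(i < w.+1) 'C(w, bump 0 i)%:R * ((-1) ^+ (bump 0 i + k) * 'C(bump 0 i, k)%:R) =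
  (w == k)%:R - 'C(w, 0)%:R * ((-1) ^+ (0 + k) * 'C(0, k)%:R) :> R.
  have := IH k; rewrite -(shift w k w.+2)// big_ord_recl /= => <-.
  by rewrite addrC addKr.
rewrite !bin0 !mul1r addrA subrKC.
case: k => [|k].
  have -> : \sum_(i < w.+1) 'C(w, i)%:R * ((-1) ^+ (bump 0 i + 0) * 'C(bump 0 i, 0)%:R) =
      - (w == 0%N)%:R :> R.
    rewrite -IH -sumrN; apply: eq_bigr => i _.
    by rewrite /bump /= add1n addSn exprS mulN1r !bin0 mulNr mulrN.
  by rewrite subrr.
have sgn i : (-1) ^+ (bump 0 i + k.+1) = (-1) ^+ (i + k) :> R.
  by rewrite /bump /= add1n addSn addnS !exprS !mulN1r opprK.
under eq_bigr => i _ do rewrite sgn /bump /= add1n binS natrD !mulrDr.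
rewrite big_split /= IH.
have -> : \sum_(i < w.+1) 'C(w, i)%:R * ((-1) ^+ (i + k) * 'C(i, k.+1)%:R) = - (w == k.+1)%:R :> R.
  rewrite -IH -sumrN; apply: eq_bigr => i _.
  by rewrite addnS exprS mulN1r mulNr mulrN opprK.
by rewrite addrA subrr add0r eqSS.
Qed.

Lemma sum_bin_poisson_coef w m K : (w < K)%N ->
  \sum_(r < K) 'C(w, r)%:R * poisson_coef m r = (w <= m)%N%:R.
Proof.
move=> wK; rewrite /poisson_coef.
under eq_bigr do rewrite mulr_sumr.
rewrite exchange_big /=; under eq_bigr do rewrite sum_bin_bin_sign//.
rewrite -natr_sum; congr _%:R.
have [wm|wm] := leqP w m.
  rewrite (bigD1 (Ordinal (wm : (w < m.+1)%N)))//= eqxx big1// => i.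
  by rewrite -val_eqE /= eq_sym => /negbTE ->.
by rewrite big1// => i _; rewrite gtn_eqF// (leq_trans (ltn_ord i)).
Qed.

Lemma poisson_coef_le m r : `|poisson_coef m r| <= 2 ^+ r.
Proof.
apply: (le_trans (ler_norm_sum _ _ _)).
under eq_bigr do rewrite normrM normrX normrN1 expr1n mul1r normr_nat.
rewrite -natr_sum -natrX ler_nat.
have := Pascal 1 1 r; rewrite addn1 => ->.
under [leqRHS]eq_bigr do rewrite !exp1n !muln1.
rewrite -(big_mkord xpredT (fun k => 'C(r, k))) -(big_mkord xpredT (fun k => 'C(r, k))).
have [mr|rm] := leqP m r.
  rewrite [leqRHS](@big_cat_nat _ _ _ m.+1)//=; exact: leq_addr.
rewrite (@big_cat_nat _ _ _ r.+1)//=; last exact: ltnW.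
rewrite [X in (_ + X)%N]big_nat_cond [X in (_ + X)%N]big1 ?addn0//.
by move=> k /andP[/andP[rk _] _]; rewrite bin_small.
Qed.

Lemma sum_exp_le (a : R) K : 0 <= a -> \sum_(r < K) a ^+ r / r`!%:R <= expR a.
Proof.
move=> a0; rewrite /expR.
have nd : nondecreasing_seq (series (exp_coeff a)).
  by apply: nondecreasing_series => n _ _; rewrite exp_coeff_ge0.
have := nondecreasing_cvgn_le nd (is_cvg_series_exp_coeff a) K.
by rewrite /series /= big_mkord.
Qed.

(** The same inversion for the Poisson law, whose r-th binomial moment is lam^r / r!. For fixed k,
    putting r = k + i splits off lam^k / k! and leaves the series of e^(- lam). *)
Lemma cvg_sum_poisson_coef (lam : R) m :
  \sum_(r < K) poisson_coef m r * (lam ^+ r / r`!%:R) @[K --> \oo] --> poisson_cdf lam m.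
Proof.
rewrite /poisson_cdf mulr_sumr.
have -> : (fun K => \sum_(r < K) poisson_coef m r * (lam ^+ r / r`!%:R)) =
   (fun K => \sum_(k < m.+1) \sum_(r < K) (-1) ^+ (r + k) * 'C(r, k)%:R * (lam ^+ r / r`!%:R)).
  apply/funext => K; rewrite exchange_big /=; apply: eq_bigr => r _.
  by rewrite /poisson_coef mulr_suml.
apply: cvg_big => [|k _]; first exact: add_continuous.
rewrite -(cvg_shiftn (val k)) /=.
have -> : (fun n => \sum_(r < n + k) (-1) ^+ (r + k) * 'C(r, k)%:R * (lam ^+ r / r`!%:R)) =
   (fun n => series (exp_coeff (- lam)) n * (lam ^+ k / k`!%:R)).
  apply/funext => n; rewrite /series /= big_mkord mulr_suml addnC big_split_ord /=.
  rewrite [X in X + _]big1 ?add0r; last first.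
    by move=> i _; rewrite bin_small ?mulr0 ?mul0r.
  apply: eq_bigr => i _; rewrite /exp_coeff.
  have := @bin_fact (k + i) k (leq_addr _ _); rewrite addKn => <-.
  have -> : (-1) ^+ (k + i + k) = (-1) ^+ i :> R.
    by rewrite [(k + i)%N]addnC -addnA addnn exprD -[_ ^+ k.*2]signr_odd odd_double mulr1.
  rewrite !natrM exprD /= [(- lam) ^+ i]exprNn.
  have : 'C(k + i, k)%:R != 0 :> R by rewrite pnatr_eq0 -lt0n bin_gt0 leq_addr.
  have : k`!%:R != 0 :> R by rewrite pnatr_eq0 -lt0n fact_gt0.
  have : i`!%:R != 0 :> R by rewrite pnatr_eq0 -lt0n fact_gt0.
  by move=> h1 h2 h3; field; rewrite h1 h2 h3.
by apply: cvgMr_tmp; rewrite /expR; exact: is_cvg_series_exp_coeff.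
Qed.

(** The r-th elementary symmetric function is at most S^r / r!. Adding a variable x reduces to the
    first two terms of the expansion of (x + S)^(r+1). *)
Lemma coef_prod_1DX_le (s : seq R) r : {in s, forall x, 0 <= x} ->
  0 <= (\prod_(x <- s) (1 + x *: 'X))`_r <= (\sum_(x <- s) x) ^+ r / r`!%:R.
Proof.
elim: s r => [|x s IH] r s0.
  rewrite !big_nil coef1; case: r => [|r] /=; first by rewrite expr0 divr1 lexx ler01.
  by rewrite expr0n mul0r lexx.
have x0 : 0 <= x by apply: s0; rewrite inE eqxx.
have {}s0 : {in s, forall y, 0 <= y} by move=> y ys; apply: s0; rewrite inE ys orbT.
have {}IH k := IH k s0.
rewrite !big_cons mulrDl mul1r coefD -scalerAl coefZ coefXM.
have S0 : 0 <= \sum_(y <- s) y.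
  by rewrite big_seq sumr_ge0.
case: r => [|r] /=.
  by rewrite mulr0 addr0 expr0; have := IH 0%N; rewrite expr0.
have /andP[h1 h2] := IH r.+1; have /andP[h3 h4] := IH r.
rewrite addr_ge0 ?mulr_ge0//=.
apply: (@le_trans _ _ ((\sum_(y <- s) y) ^+ r.+1 / r.+1`!%:R +
   x * ((\sum_(y <- s) y) ^+ r / r`!%:R))); first by rewrite lerD// ler_wpM2l.
move: (\sum_(y <- s) y) S0 => S S0.
have f0 : 0 < r`!%:R :> R by rewrite ltr0n fact_gt0.
rewrite ler_pdivlMr ?ltr0n ?fact_gt0// factS natrM.
have -> : (S ^+ r.+1 / (r.+1%:R * r`!%:R) + x * (S ^+ r / r`!%:R)) * (r.+1%:R * r`!%:R) =
   S ^+ r.+1 + r.+1%:R * x * S ^+ r.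
  have : r.+1%:R != 0 :> R by rewrite pnatr_eq0.
  by move: (r.+1%:R) => u u0; field; rewrite u0 gt_eqF.
elim: r {h1 h2 h3 h4 f0} => [|r IHr]; first by rewrite !expr1 expr0 mulr1 mul1r addrC.
rewrite [leRHS]exprS.
have xS : 0 <= x + S by rewrite addr_ge0.
apply: le_trans (ler_wpM2l xS IHr).
have Sr : 0 <= S ^+ r by rewrite exprn_ge0.
have rx : 0 <= r.+1%:R * x ^+ 2 * S ^+ r by rewrite !mulr_ge0// sqr_ge0.
by rewrite -[r.+2%:R]natr1 !exprS; lra.
Qed.

(** From 1 - x <= e^(- x) follows e^x (1 - x^2) <= 1 + x; the factors 1 - x^2 are multiplied by
    dropping positive cross terms, unless the left side is already nonpositive. *)
Lemma prod_1D_ge (s : seq R) : {in s, forall x, 0 <= x <= 1} ->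
  expR (\sum_(x <- s) x) * (1 - \sum_(x <- s) x ^+ 2) <= \prod_(x <- s) (1 + x).
Proof.
elim: s => [|x s IH] s0; first by rewrite !big_nil expR0 subr0 mul1r.
have /andP[x0 x1] : 0 <= x <= 1 by apply: s0; rewrite inE eqxx.
have {}s0 y : y \in s -> 0 <= y <= 1 by move=> ys; apply: s0; rewrite inE ys orbT.
have {IH}h := IH s0; rewrite !big_cons.
have P0 : 0 <= \prod_(y <- s) (1 + y).
  by rewrite big_seq prodr_ge0// => y /s0/andP[y0 _]; rewrite addr_ge0.
have S0 : 0 <= \sum_(y <- s) y ^+ 2 by rewrite sumr_ge0// => y _; rewrite sqr_ge0.
have e0 := expR_gt0 (\sum_(y <- s) y).
have [s1|s1] := leP 1 (x ^+ 2 + \sum_(y <- s) y ^+ 2).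
  rewrite (@le_trans _ _ 0)// ?mulr_ge0 ?addr_ge0//.
  by rewrite mulr_ge0_le0 ?expR_ge0// subr_le0.
rewrite expRD.
have ex : expR x * (1 - x ^+ 2) <= 1 + x.
  have h1 : 1 - x <= expR (- x) by have := expR_ge1Dx (- x); rewrite addrC.
  have -> : 1 - x ^+ 2 = (1 + x) * (1 - x) by ring.
  rewrite mulrCA -[leRHS]mulr1 ler_wpM2l ?addr_ge0//.
  by rewrite -[leRHS](expRxMexpNx_1 x) ler_wpM2l ?expR_ge0.
have ex0 := expR_gt0 x; have x20 := sqr_ge0 x.
apply: (@le_trans _ _ ((expR x * (1 - x ^+ 2)) * (expR (\sum_(y <- s) y) * (1 - \sum_(y <- s) y ^+ 2)))).
  have -> : forall a b c d : R, a * b * (c * d) = a * c * (b * d) by move=> *; ring.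
  rewrite ler_wpM2l ?mulr_ge0 ?expR_ge0//.
  by have := mulr_ge0 x20 S0; lra.
apply: ler_pM => //; rewrite mulr_ge0 ?expR_ge0// subr_ge0; lra.
Qed.

Lemma bin_le_expn n r : ('C(n, r) <= n ^ r)%N.
Proof.
apply: (@leq_trans (n ^_ r)); first by rewrite -bin_ffact leq_pmulr// fact_gt0.
elim: r => [|r IH]; first by rewrite ffactn0 expn0.
by rewrite ffactnSr expnSr leq_mul// leq_subr.
Qed.

(** * Binomial moments and distribution of the number of prime factors in a finite set *)

Section PrimeFactorCount.
Variables (M : nat) (P : {set 'I_M}).
Hypothesis P_prime : forall p, p \in P -> prime p.

Definition omega_in n : nat := #|[set p in P | (p %| n)%N]|.

Let prod_dvdn (A : {set 'I_M}) n : A \subset P ->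
  (\prod_(p in A) p %| n)%N = (A \subset [set p in P | (p %| n)%N]).
Proof.
move=> /fintype.subsetP AP; rewrite -big_enum -(big_map val xpredT id) prod_primes_dvdn.
- apply/allP/fintype.subsetP => h p.
    by move=> pA; rewrite inE AP//=; apply: h; rewrite map_f// mem_enum.
  by case/mapP => q; rewrite mem_enum => /h; rewrite inE => /andP[_ qn] ->.
- by rewrite map_inj_uniq ?enum_uniq//; exact: val_inj.
- by apply/allP => p /mapP[q]; rewrite mem_enum => /AP/P_prime qp ->.
Qed.

(** Double counting: 'C(omega_in n, r) is the number of r-subsets of P whose product divides n. *)
Lemma sum_bin_omega_in N r : \sum_(1 <= n < N.+1) 'C(omega_in n, r) =
  \sum_(A : {set 'I_M} | (A \subset P) && (#|A| == r)) (N %/ \prod_(p in A) p)%N.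
Proof.
under [RHS]eq_bigr do rewrite divn_count_dvd.
rewrite exchange_big /=; apply: eq_bigr => n _.
rewrite /omega_in -cards_draws -sum1_card big_mkcond [RHS]big_mkcond /=.
apply: eq_bigr => A _; rewrite inE.
have [AP|AP] /= := boolP (A \subset P).
  by rewrite prod_dvdn//; case: (#|A| == r); rewrite ?andbT ?andbF//; case: (_ \subset _).
case: ifP => // /andP[/fintype.subsetP h _]; case/negP: AP; apply/fintype.subsetP => p /h.
by rewrite inE => /andP[].
Qed.

(** The r-th elementary symmetric function of the reciprocals: the binomial moment before rounding
    to integers. *)
Let elem r : R := \sum_(A : {set 'I_M} | (A \subset P) && (#|A| == r))
  \prod_(p in A) p%:R^-1.

Let genpoly : {poly R} := \prod_(p in P) (1 + p%:R^-1 *: 'X).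

Let genpolyE : genpoly = \sum_(A : {set 'I_M} | A \subset P)
  (\prod_(p in A) p%:R^-1) *: 'X^#|A|.
Proof.
transitivity (\prod_(p : 'I_M) ((if p \in P then p%:R^-1 *: 'X else 0) + 1 : {poly R})).
  rewrite /genpoly big_mkcond /=; apply: eq_bigr => p _.
  by case: ifP; rewrite ?add0r// addrC.
rewrite bigA_distr /= [RHS]big_mkcond /=; apply: eq_bigr => A _.
case: ifPn => [/fintype.subsetP AP|/fintype.subsetPn[p pA pP]]; last first.
  by rewrite (bigD1 p)//= pA (negbTE pP) mul0r.
rewrite -big_mkcond /=.
under eq_bigr => p pA do rewrite AP//.
by rewrite scaler_prod prodr_const.
Qed.

Let elemE r : elem r = genpoly`_r.
Proof.
rewrite genpolyE coef_sum [RHS]big_mkcond [LHS]big_mkcond /=.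
apply: eq_bigr => A _; case: (A \subset P) => //=.
by rewrite coefZ coefXn eq_sym; case: ifP; rewrite ?mulr1 ?mulr0.
Qed.

Let lam : R := \sum_(p in P) p%:R^-1.

Let genpoly_map : genpoly = \prod_(x <- [seq (p%:R : R)^-1 | p : 'I_M <- enum P]) (1 + x *: 'X).
Proof. by rewrite big_map big_enum. Qed.

Let lam_map : lam = \sum_(x <- [seq (p%:R : R)^-1 | p : 'I_M <- enum P]) x.
Proof. by rewrite big_map big_enum. Qed.

Let elem_le r : 0 <= elem r <= lam ^+ r / r`!%:R.
Proof.
rewrite elemE genpoly_map lam_map; apply: coef_prod_1DX_le => x /mapP[p _ ->].
by rewrite invr_ge0.
Qed.

(** Evaluation of the generating polynomial at 2, since 2^r bounds the r-th inversion
    coefficient. *)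
Let sum_elem K : (size genpoly <= K)%N ->
  \sum_(r < K) 2 ^+ r * elem r = \prod_(p in P) (1 + 2 * p%:R^-1).
Proof.
move=> sK; have -> : \sum_(r < K) 2 ^+ r * elem r = \sum_(r < K) genpoly`_r * 2 ^+ r.
  by apply: eq_bigr => r _; rewrite elemE mulrC.
rewrite -horner_coef_wide// /genpoly horner_prod; apply: eq_bigr => p _.
by rewrite !hornerE mulrC.
Qed.

Let moment N r : R := (\sum_(1 <= n < N.+1) 'C(omega_in n, r))%:R / N%:R.

Let prod_inv (A : {set 'I_M}) : \prod_(p in A) (p%:R : R)^-1 = (\prod_(p in A) p)%N%:R^-1.
Proof. by rewrite natr_prod prodfV. Qed.

Let moment_le N r : (0 < N)%N -> moment N r <= elem r.
Proof.
move=> N0; rewrite /moment ler_pdivrMr ?ltr0n// sum_bin_omega_in natr_sum mulr_suml.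
by apply: ler_sum => A _; rewrite prod_inv mulrC; exact: natr_divn_le.
Qed.

Let moment_ge N r : (0 < N)%N -> elem r - moment N r <= #|P|%:R ^+ r / N%:R.
Proof.
move=> N0; have NR0 : 0 < N%:R :> R by rewrite ltr0n.
rewrite lerBlDr -mulrDl ler_pdivlMr// -lerBlDr.
rewrite sum_bin_omega_in natr_sum /elem mulr_suml -sumrB.
apply: (@le_trans _ _ (\sum_(A : {set 'I_M} | (A \subset P) && (#|A| == r)) 1%:R)).
  apply: ler_sum => A /andP[/fintype.subsetP AP _]; rewrite prod_inv lerBlDr -lerBlDl mulrC.
  rewrite natr_divn_ge// prodn_cond_gt0// => p pA; apply: prime_gt0.
  by apply: P_prime; exact: AP.
rewrite -natr_sum sum1_card -cardsE cards_draws -natrX ler_nat.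
by rewrite (leq_trans (bin_le_expn _ _)).
Qed.

Let moment_ge0 N r : 0 <= moment N r.
Proof. by rewrite divr_ge0. Qed.

Let freq N m : R := (\sum_(1 <= n < N.+1) (omega_in n <= m)%N)%:R / N%:R.

Let freqE N m K : (M < K)%N ->
  freq N m = \sum_(r < K) poisson_coef m r * moment N r.
Proof.
move=> MK; transitivity ((\sum_(r < K) poisson_coef m r *
    (\sum_(1 <= n < N.+1) 'C(omega_in n, r))%:R) / N%:R); last first.
  by rewrite mulr_suml; apply: eq_bigr => r _; rewrite mulrA.
congr (_ / _).
under [RHS]eq_bigr do rewrite natr_sum mulr_sumr.
rewrite [RHS]exchange_big /= natr_sum; apply: eq_bigr => n _.
rewrite -(@sum_bin_poisson_coef _ _ K).
  by apply: eq_bigr => r _; rewrite mulrC.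
by rewrite (leq_ltn_trans _ MK)// (leq_trans (max_card _))// card_ord.
Qed.

(** Each moment error splits into lam^r / r! - [elem r] and [elem r] - [moment N r], both
    nonnegative. Weighted by 2^r, the former sum to at most e^(2 lam) minus the product of 1 + 2/p,
    the first error term. The latter is a rounding error for r < T; for r >= T it is at most lam^r /
    r!, and 2^r = 8^r / 4^r <= 8^r / 4^T bounds the tail. *)
Lemma omega_in_poisson N T Y m : (0 < N)%N -> (#|P| <= Y)%N -> (0 < Y)%N ->
  `|(\sum_(1 <= n < N.+1) (omega_in n <= m)%N)%:R / N%:R -
    poisson_cdf (\sum_(p in P) p%:R^-1 : R) m| <=
  expR (2 * \sum_(p in P) p%:R^-1) * (4 * \sum_(p in P) p%:R^-1 ^+ 2) +
  T%:R * ((2 * Y)%:R ^+ T / N%:R) + expR (8 * \sum_(p in P) p%:R^-1) / 4 ^+ T.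
Proof.
move=> N0 PY Y0; have NR0 : 0 < N%:R :> R by rewrite ltr0n.
rewrite -/(freq N m) -/lam; set B := (X in _ <= X).
have lam0 : 0 <= lam by apply: sumr_ge0 => p _; rewrite invr_ge0.
have bound K : (M < K)%N -> (size genpoly <= K)%N -> (T <= K)%N ->
    `|freq N m - \sum_(r < K) poisson_coef m r * (lam ^+ r / r`!%:R)| <= B.
  move=> MK sK TK; rewrite (freqE _ _ MK) -sumrB.
  apply: (le_trans (ler_norm_sum _ _ _)).
  apply: (@le_trans _ _ (\sum_(r < K) ((2 ^+ r * (lam ^+ r / r`!%:R) - 2 ^+ r * elem r) +
      ((if (r < T)%N then (2 * Y)%:R ^+ T / N%:R else 0) + (8 * lam) ^+ r / r`!%:R / 4 ^+ T)))).
    apply: ler_sum => r _; have /andP[e0 el] := elem_le r.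
    have h1 := moment_le r N0; have h2 := moment_ge r N0; have h3 := moment_ge0 N r.
    rewrite -mulrBr normrM; apply: (@le_trans _ _ (2 ^+ r * (lam ^+ r / r`!%:R - moment N r))).
      rewrite distrC [X in _ * X]ger0_norm ?subr_ge0 ?(le_trans h1 el)//.
      by rewrite ler_wpM2r ?subr_ge0 ?(le_trans h1 el)// poisson_coef_le.
    rewrite -mulrBr.
    have -> : 2 ^+ r * (lam ^+ r / r`!%:R - moment N r) = 2 ^+ r * (lam ^+ r / r`!%:R - elem r) +
       2 ^+ r * (elem r - moment N r) by rewrite -mulrDr addrA subrK.
    rewrite lerD2l; have t0 : 0 <= (8 * lam) ^+ r / r`!%:R / 4 ^+ T.
      by rewrite !divr_ge0 ?exprn_ge0 ?mulr_ge0.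
    case: ifP => rT.
      rewrite -[leLHS]addr0 lerD//.
      apply: (@le_trans _ _ (2 ^+ r * (#|P|%:R ^+ r / N%:R))); first by rewrite ler_wpM2l ?exprn_ge0.
      rewrite mulrA -exprMn ler_pM2r ?invr_gt0// -natrM -!natrX ler_nat.
      apply: (@leq_trans ((2 * Y) ^ r)); last by rewrite leq_pexp2l ?muln_gt0// ltnW.
      by case: (nat_of_ord r) => [|k]; rewrite ?expn0// leq_exp2r// leq_mul2l PY.
    rewrite add0r; apply: (@le_trans _ _ (2 ^+ r * (lam ^+ r / r`!%:R))).
      by rewrite ler_wpM2l ?exprn_ge0// lerBlDr (le_trans el)// lerDl.
    have -> : 2 ^+ r * (lam ^+ r / r`!%:R) = (8 * lam) ^+ r / r`!%:R / 4 ^+ r :> R.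
      have -> : 8 = 2 * 4 :> R by rewrite -natrM.
      rewrite !exprMn; have : (4 : R) ^+ r != 0 by rewrite expf_neq0.
      have : r`!%:R != 0 :> R by rewrite pnatr_eq0 -lt0n fact_gt0.
      by move=> f0 f40; field; rewrite f0 f40.
    rewrite ler_wpM2l ?divr_ge0 ?exprn_ge0 ?mulr_ge0// lef_pV2 ?posrE ?exprn_gt0//.
    by rewrite ler_eXn2l ?ltr1n// leqNgt rT.
  rewrite !big_split /= sumrN sum_elem// /B -[leRHS]addrA; apply: lerD.
    have := @prod_1D_ge [seq 2 * (p%:R : R)^-1 | p : 'I_M <- enum P].
    rewrite !big_map !big_enum /= => h.
    have {h} := h _; under [\sum_(i in P) (2 * _) ^+ 2]eq_bigr do rewrite exprMn.
    rewrite -!mulr_sumr (_ : 2 ^+ 2 = 4); last by rewrite -natrX.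
    move=> h.
    have e : \sum_(r < K) 2 ^+ r * (lam ^+ r / r`!%:R) <= expR (2 * lam).
      apply: le_trans (sum_exp_le K _); last by rewrite mulr_ge0.
      by apply: ler_sum => r _; rewrite mulrA -exprMn.
    have {}h : expR (2 * lam) * (1 - 4 * \sum_(p in P) p%:R^-1 ^+ 2) <=
        \prod_(p in P) (1 + 2 * p%:R^-1).
      apply: h => x /mapP[p]; rewrite mem_enum => /P_prime/prime_gt1 p1 ->.
      rewrite mulr_ge0 ?invr_ge0//= ler_pdivrMr ?mul1r ?ler_nat//.
      by rewrite ltr0n ltnW.
    by move: h; rewrite mulrBr mulr1; move: (expR _ * _) => *; lra.
  rewrite -mulr_suml lerD//; last by rewrite ler_wpM2r ?invr_ge0 ?exprn_ge0// sum_exp_le// mulr_ge0.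
  rewrite -big_mkcond /= -(big_ord_widen K (fun=> (2 * Y)%:R ^+ T / N%:R) TK).
  by rewrite sumr_const card_ord mulr_natl.
(* The frequency and the bound B do not depend on K, so letting K tend to infinity replaces the
   truncated sum by the Poisson distribution function. *)
apply: (@ler_cvg_to _ \oo _ _
  (fun K => `|freq N m - \sum_(r < K) poisson_coef m r * (lam ^+ r / r`!%:R)|) (cst B)).
- apply: cvg_norm; apply: cvgB; first exact: cvg_cst.
  exact: cvg_sum_poisson_coef.
- exact: cvg_cst.
- near=> K; apply: bound; near: K; [exact: nbhs_infty_gt| |]; exact: nbhs_infty_ge.
Unshelve. all: by end_near. Qed.

Let elem1 : elem 1 = lam.
Proof.
rewrite /elem (eq_bigl (mem [set [set p] | p in P]%SET)); last first.
  move=> A /=; apply/andP/imsetP => [[AP /cards1P[p Ap]]|[p pP ->]].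
    by exists p => //; move: AP; rewrite Ap finset.sub1set.
  by rewrite finset.sub1set pP cards1.
rewrite big_imset /=; last by move=> p q _ _ /finset.set1_inj.
by apply: eq_bigr => p _; rewrite big_set1.
Qed.

Let sqr_bin2 w : w%:R ^+ 2 = 2 * 'C(w, 2)%:R + w%:R :> R.
Proof.
elim: w => [|w IH]; first by rewrite expr0n mulr0 addr0.
by rewrite binS bin1 natrD -natr1; move: IH; rewrite !expr2; lra.
Qed.

(* Chebyshev's inequality: E W = lam + O(1/N) and E W^2 <= lam^2 + lam. *)
Lemma omega_in_le_small N C : (0 < N)%N -> C%:R < \sum_(p in P) p%:R^-1 :> R ->
  (\sum_(1 <= n < N.+1) (omega_in n <= C)%N)%:R / N%:R <=
  (\sum_(p in P) p%:R^-1) * (1 + 2 * (#|P|%:R / N%:R)) /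
    ((\sum_(p in P) p%:R^-1) - C%:R) ^+ 2 :> R.
Proof.
move=> N0; rewrite -/lam => Clam; have NR0 : 0 < N%:R :> R by rewrite ltr0n.
have lam0 : 0 <= lam by apply: sumr_ge0 => p _; rewrite invr_ge0.
rewrite ler_pdivlMr ?exprn_gt0 ?subr_gt0//.
have m2 := le_trans (moment_le 2 N0) (andP (elem_le 2)).2.
have m1 := moment_le 1 N0; have m1' := moment_ge 1 N0; rewrite elem1 expr1 in m1 m1'.
apply: (@le_trans _ _ ((\sum_(1 <= n < N.+1) ((omega_in n)%:R - lam) ^+ 2) / N%:R)).
  rewrite mulrAC ler_pM2r ?invr_gt0// natr_sum mulr_suml ler_sum// => n _.
  have [wC|wC] := leqP _ C; last by rewrite mul0r sqr_ge0.
  rewrite mul1r -[leRHS]sqrrN opprB ler_sqr ?nnegrE ?subr_ge0 ?(ltW Clam)//.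
    by rewrite lerD2l lerN2 ler_nat.
  by apply: le_trans (ltW Clam); rewrite ler_nat.
have -> : (\sum_(1 <= n < N.+1) ((omega_in n)%:R - lam) ^+ 2) / N%:R =
   2 * moment N 2 + moment N 1 - 2 * lam * moment N 1 + lam ^+ 2.
  have -> : \sum_(1 <= n < N.+1) ((omega_in n)%:R - lam) ^+ 2 =
     \sum_(1 <= n < N.+1) (2 * 'C(omega_in n, 2)%:R + 'C(omega_in n, 1)%:R
       - 2 * lam * 'C(omega_in n, 1)%:R + lam ^+ 2).
    by apply: eq_bigr => n _; rewrite sqrrB sqr_bin2 bin1 mulr_natl; ring.
  rewrite !big_split /= sumrN -!mulr_sumr sumr_const_nat subn1 /= -!natr_sum -mulr_natr.
  by rewrite /moment; field; rewrite gt_eqF.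
move: m2; rewrite (_ : 2`!%:R = 2)//; move: (moment N 2) (moment N 1) m1 m1' => M2 M1.
by move: (#|P|%:R / N%:R) => q *; nra.
Qed.

End PrimeFactorCount.
End PoissonApproximation.

(** * Representations and divisors of squares *)

Section RepresentationBounds.
Implicit Types (a b n p : nat) (s : seq nat).

Fixpoint square_divisors s : seq nat :=
  if s is p :: s' then [seq p ^ i * e | i <- iota 0 3, e <- square_divisors s']%N
  else [:: 1%N].

Lemma square_divisors_dvdn s e : e \in square_divisors s -> (e %| (\prod_(p <- s) p) ^ 2)%N.
Proof.
elim: s e => [|p s IH] e; first by rewrite /= inE => /eqP ->.
move=> /allpairsP[[i e']] /= [i3 /IH es ->].
by rewrite big_cons expnMn dvdn_mul// dvdn_exp2l//; move: i3; rewrite !inE; lia.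
Qed.

Lemma square_divisors_uniq s : uniq s -> all prime s -> uniq (square_divisors s).
Proof.
elim: s => [//|p s IH]; rewrite [uniq _]/= [all _ _]/= => /andP[ps us] /andP[pp ap].
rewrite -[square_divisors _]/[seq p ^ i * e | i <- iota 0 3, e <- square_divisors s]%N.
apply: allpairs_uniq; rewrite ?IH// => -[i1 e1] [i2 e2] h1 h2 /= E.
have {}h1 : e1 \in square_divisors s by case/allpairsP: h1 => -[? ?] /= [_ ? [_ ->]].
have {}h2 : e2 \in square_divisors s by case/allpairsP: h2 => -[? ?] /= [_ ? [_ ->]].
have cop e : e \in square_divisors s -> coprime p e.
  move=> /square_divisors_dvdn h; apply: coprime_dvdr h _.
  by rewrite coprimeXr// coprime_prod_primes.
have p0 := prime_gt0 pp.
have pos e : e \in square_divisors s -> (0 < e)%N.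
  move=> /square_divisors_dvdn /dvdn_gt0; apply.
  by rewrite expn_gt0 big_seq prodn_cond_gt0// => q /(allP ap) /prime_gt0.
have lg k e : e \in square_divisors s -> logn p (p ^ k * e) = k.
  by move=> h; rewrite lognM ?expn_gt0 ?p0 ?pos// pfactorK// (logn_coprime (cop _ h)) addn0.
have ij : i1 = i2 by rewrite -(lg i1 e1 h1) E (lg i2 e2 h2).
move: E; rewrite ij => /eqP; rewrite eqn_pmul2l ?expn_gt0 ?p0// => /eqP ->.
by [].
Qed.

(** For x = m (D + e) / a and y = m (D + e') / a, a x - n = m e and a y - n = m e', with product (m
    D)^2 = n^2. *)
Lemma mem_representations a n m D e e' : (0 < a)%N -> (0 < n)%N ->
  n = (m * D)%N -> (e * e' = D ^ 2)%N -> (a %| D + e)%N -> (a %| D + e')%N ->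
  representations n a (m * ((D + e) %/ a), m * ((D + e') %/ a))%N.
Proof.
move=> a0 n0 nE eE /dvdnP[u uE] /dvdnP[v vE].
rewrite uE vE !mulnK//.
have [m0 D0] : (0 < m)%N /\ (0 < D)%N by move: n0; rewrite nE muln_gt0 => /andP.
have [e0 e'0] : (0 < e)%N /\ (0 < e')%N.
  by apply/andP; rewrite -muln_gt0 eE expn_gt0 D0.
have u0 : (0 < u)%N by case: u uE => //; rewrite mul0n; lia.
have v0 : (0 < v)%N by case: v vE => //; rewrite mul0n; lia.
split; rewrite /= ?muln_gt0 ?m0//.
have key : (a * (u * v) = D * (u + v))%N.
  have : (a * a * (u * v) = a * (D * (u + v)))%N.
    have -> : (a * a * (u * v) = (u * a) * (v * a))%N by ring.
    have -> : (a * (D * (u + v)) = D * (u * a) + D * (v * a))%N by ring.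
    by rewrite -uE -vE mulnDl !mulnDr eE; ring.
  by rewrite -mulnA => /eqP; rewrite eqn_pmul2l// => /eqP.
have := congr1 (fun x : nat => x%:R : rat) key.
rewrite !natrM natrD nE !natrM => {}key.
have nz k : (0 < k)%N -> k%:R != 0 :> rat by rewrite pnatr_eq0 -lt0n.
have h1 := nz _ m0; have h2 := nz _ D0; have h3 := nz _ u0; have h4 := nz _ v0.
apply: (@mulIf _ (u%:R * v%:R * (m%:R * D%:R))); first by rewrite !mulf_neq0.
transitivity ((a%:R * (u%:R * v%:R)) : rat); first by field; rewrite h1 h2.
by rewrite key; field; rewrite h1 h3 h4.
Qed.

Definition residue_divisors b s : seq nat :=
  [seq e <- square_divisors s | ((\prod_(p <- s) p)%:R + e%:R == 0 :> 'Z_b)%R].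

Lemma natr_Zp_eq0 b k : (1 < b)%N -> (k%:R == 0 :> 'Z_b) = (b %| k)%N.
Proof. by move=> b1; rewrite -val_eqE /= val_Zp_nat. Qed.

(** D is a unit mod b, so e = - D and e e' = D^2 force e' = - D too: a divides both D + e and D +
    e'. The map is injective because x determines D + e. *)
Lemma size_residue_divisors_le a b n s : (0 < a)%N -> (1 < b)%N -> (a %| b)%N -> (0 < n)%N ->
  uniq s -> all prime s -> all (coprime b) s -> all (dvdn^~ n) s ->
  (size (residue_divisors b s) <= repr_count n a)%N.
Proof.
move=> a0 b1 ab n0 us ps cs ds.
set D := (\prod_(p <- s) p)%N.
have Dn : (D %| n)%N by rewrite prod_primes_dvdn.
have D0 : (0 < D)%N := dvdn_gt0 n0 Dn.
have cD : coprime b D.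
  rewrite /D big_seq; apply: (big_ind (coprime b)) => [|x y hx hy|p /(allP cs)//]; first exact: coprimen1.
  by rewrite coprimeMr hx.
pose f e := (n %/ D * ((D + e) %/ a), n %/ D * ((D + D ^ 2 %/ e) %/ a))%N.
rewrite -(size_map f); apply: uniq_leq_size.
- rewrite map_inj_in_uniq ?filter_uniq ?square_divisors_uniq//.
  move=> e1 e2; rewrite !mem_filter => /andP[h1 _] /andP[h2 _] [E _].
  have nD : (0 < n %/ D)%N by rewrite divn_gt0// dvdn_leq.
  move: h1 h2 E; rewrite -!natrD !natr_Zp_eq0// => /(dvdn_trans ab) h1 /(dvdn_trans ab) h2 /eqP.
  by rewrite eqn_pmul2l// eqn_div// divnK// eqn_add2l => /eqP.
move=> x /mapP[e]; rewrite mem_filter => /andP[he es] ->.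
rewrite in_fset_set ?inE; last exact: finite_representations.
have ed := square_divisors_dvdn es; rewrite -/D in ed.
rewrite -/D in he.
have he1 : (a %| D + e)%N by apply: (dvdn_trans ab); rewrite -natr_Zp_eq0// natrD.
apply: mem_representations => //; [by rewrite divnK|by rewrite mulnC divnK|].
apply: (dvdn_trans ab); rewrite -natr_Zp_eq0// natrD.
have uD : (D%:R : 'Z_b) \is a GRing.unit by rewrite unitZpE.
have eq : (e * (D ^ 2 %/ e))%N = (D ^ 2)%N by rewrite mulnC divnK.
move: he; rewrite addr_eq0 => /eqP he.
by apply/eqP/(mulrI uD); rewrite mulr0 mulrDr [X in _ + X * _]he mulNr -!natrM eq -mulnn subrr.
Qed.

(** This is Omega(n) for 0 < n <= B; a range independent of n lets the sums over n and p be
    exchanged. *)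
Definition bigomega B n : nat := (\sum_(0 <= p < B.+1 | prime p) logn p n)%N.

Lemma bigomega_prime_mul B p n : prime p -> (p <= B)%N -> (0 < n)%N ->
  bigomega B (p * n) = (bigomega B n).+1.
Proof.
move=> pp pB n0; rewrite /bigomega.
under eq_bigr => q qq do rewrite (lognM q (prime_gt0 pp) n0) (logn_prime q pp).
rewrite big_split /= (big_rem p); last by rewrite mem_index_iota.
rewrite pp eqxx big_seq_cond big1 ?addn0// => q.
rewrite (mem_rem_uniq _ (iota_uniq _ _)) inE => /andP[/andP[qp _] _].
by rewrite (negbTE qp).
Qed.

(** For n = p m with p prime, a divisor d of n^2 is p^i times a divisor of m^2, where i is the
    exponent of p in d capped at 2: if the cap is not reached, the cofactor is coprime to p. *)
Lemma size_divisors_sqr_le B n : (0 < n <= B)%N ->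
  (size (divisors (n ^ 2)) <= 3 ^ bigomega B n)%N.
Proof.
have [k] := ubnP n; elim: k n => // k IH n nk /andP[n0 nB].
have [n1|n1] := leqP n 1.
  have -> : n = 1%N by lia.
  by rewrite exp1n (_ : divisors 1 = [:: 1%N])//= expn_gt0.
have pp := pdiv_prime n1; set p := pdiv n in pp.
have /dvdnP[m nE] : (p %| n)%N by exact: pdiv_dvd.
rewrite mulnC in nE.
have p1 := prime_gt1 pp.
have m0 : (0 < m)%N by move: n0; rewrite nE muln_gt0 => /andP[].
have mn : (m < n)%N by rewrite nE; nia.
have pB : (p <= B)%N by apply: leq_trans nB; rewrite dvdn_leq// pdiv_dvd.
rewrite nE bigomega_prime_mul// [leqRHS]expnS.
have := IH m _ _; rewrite (leq_trans mn _)// => /(_ isT).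
rewrite m0 (leq_trans (ltnW mn) nB) => /(_ isT) h.
apply: leq_trans (leq_mul (leqnn 3) h).
rewrite -(size_iota 0 3) -(size_allpairs (fun i d => p ^ i * d)%N).
apply: uniq_leq_size; first exact: divisors_uniq.
move=> d; rewrite -dvdn_divisors ?expn_gt0 ?muln_gt0 ?m0 ?prime_gt0// => dd.
have d0 : (0 < d)%N by apply: dvdn_gt0 dd; rewrite expn_gt0 muln_gt0 m0 prime_gt0.
apply/allpairsP; exists (minn 2 (logn p d), d %/ p ^ minn 2 (logn p d))%N; split => /=.
- by rewrite !inE; lia.
- rewrite -dvdn_divisors ?expn_gt0 ?m0//.
  have dE : d = (d %/ p ^ minn 2 (logn p d) * p ^ minn 2 (logn p d))%N.
    by rewrite divnK// (dvdn_trans _ (pfactor_dvdnn p d))// dvdn_exp2l// geq_minr.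
  have [l2|l2] := leqP 2 (logn p d).
    move: dd; rewrite {1}dE (minn_idPl l2) expnMn mulnC dvdn_pmul2l//.
    by rewrite expn_gt0 prime_gt0.
  rewrite (minn_idPr (ltnW l2)) in dE *.
  have /Gauss_dvdr <- : coprime (d %/ p ^ logn p d) (p ^ 2).
    have [d' cp] := pfactor_coprime pp d0; move=> E.
    by rewrite {1}E mulnK ?expn_gt0 ?prime_gt0// coprime_sym coprimeXl.
  by rewrite -expnMn; apply: dvdn_trans dd; rewrite dvdn_div ?pfactor_dvdnn.
- by rewrite mulnC divnK// (dvdn_trans _ (pfactor_dvdnn p d))// dvdn_exp2l// geq_minr.
Qed.

Lemma repr_count_le a n B : (0 < a)%N -> (0 < n <= B)%N ->
  (repr_count n a <= 3 ^ bigomega B n)%N.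
Proof.
move=> a0 /[dup] nB /andP[n0 _].
apply: leq_trans (size_divisors_sqr_le nB).
have key x y : (x, y) \in fset_set (representations n a) ->
    [/\ (n < a * x)%N, ((a * x - n) * (a * y - n) = n ^ 2)%N & (n < a * y)%N].
  rewrite in_fset_set; last exact: finite_representations.
  rewrite inE => -[/= x0 y0 E].
  have {}E : (a * (x * y) = n * (x + y))%N.
    apply/eqP; rewrite -(eqr_nat rat) !natrM natrD; apply/eqP.
    have nz k : (0 < k)%N -> k%:R != 0 :> rat by rewrite pnatr_eq0 -lt0n.
    have h1 := nz _ n0; have h2 := nz _ x0; have h3 := nz _ y0.
    have -> : a%:R * (x%:R * y%:R) = n%:R * (x%:R * y%:R) * (a%:R / n%:R) :> rat.
      by field.
    by rewrite E; field; rewrite h2 h3.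
  have h1 : (n < a * x)%N by nia.
  have h2 : (n < a * y)%N by nia.
  split => //; have : (a * x * (a * y) = n * (a * x) + n * (a * y))%N by nia.
  by nia.
rewrite /repr_count -(size_map (fun z : nat * nat => a * z.1 - n)%N).
apply: uniq_leq_size.
  rewrite map_inj_in_uniq ?fset_uniq//.
  move=> [x1 y1] [x2 y2] /key[/= h1 h2 h3] /key[h4 h5 h6] /= E.
  have ex : (a * x1 = a * x2)%N by lia.
  have ey : (a * y1 = a * y2)%N.
    have : ((a * x1 - n) * (a * y1 - n) = (a * x1 - n) * (a * y2 - n))%N by rewrite h2 E.
    move=> /eqP; rewrite eqn_pmul2l ?subn_gt0// => /eqP; lia.
  by move: ex ey => /eqP; rewrite eqn_pmul2l// => /eqP -> /eqP; rewrite eqn_pmul2l// => /eqP ->.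
move=> d /mapP[[x y] /key[/= h1 h2 h3] ->].
by rewrite -dvdn_divisors ?expn_gt0 ?n0// -h2 dvdn_mulr.
Qed.

End RepresentationBounds.

(** * Covering the unit classes by few primes *)

Section Covering.
Variable b : nat.
Hypothesis b_gt1 : (1 < b)%N.
Implicit Types (p : nat) (s : seq nat) (X : {set 'Z_b}).

Definition Zp_units : {set 'Z_b} := [set x | x \is a GRing.unit].

Definition covered s : {set 'Z_b} := [set x | x \in [seq e%:R | e <- square_divisors s]].

Lemma covered_consP p s x : reflect
  (exists i y, [/\ (i < 3)%N, y \in covered s & x = p%:R ^+ i * y])
  (x \in covered (p :: s)).
Proof.
rewrite inE; apply: (iffP mapP) => [[e] /allpairsP[[i e']] /= [i3 es ->] ->|[i] [y] [i3]].
  exists i, e'%:R; rewrite natrM natrX; split => //; first by move: i3; rewrite !inE; lia.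
  by rewrite inE map_f.
rewrite inE => /mapP[e es ->] ->; exists (p ^ i * e)%N; last by rewrite natrM natrX.
by apply/allpairsP; exists (i, e); split => //=; rewrite !inE; lia.
Qed.

Lemma covered_unit s : all (coprime b) s -> covered s \subset Zp_units.
Proof.
elim: s => [|p s IH] /=.
  by move=> _; apply/fintype.subsetP => x; rewrite !inE => /eqP ->; exact: unitr1.
move=> /andP[bp /IH /fintype.subsetP h]; apply/fintype.subsetP => x /covered_consP[i [y [_ /h yU ->]]].
by move: yU; rewrite !inE => yU; rewrite unitrM unitrX// unitZpE.
Qed.

Lemma one_covered s : 1 \in covered s.
Proof.
elim: s => [|p s IH]; first by rewrite !inE.
by apply/covered_consP; exists 0%N, 1; rewrite expr0 mul1r.
Qed.

Lemma covered_sub_cons p s : covered s \subset covered (p :: s).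
Proof.
by apply/fintype.subsetP => x xs; apply/covered_consP; exists 0%N, x; rewrite expr0 mul1r.
Qed.

Definition stabilizes X : pred 'Z_b := fun g => [forall x in X, g * x \in X].

(** X stands for a class set reached so far. At most #|Zp_units| primes are ever chosen, so more
    non-stabilizing primes than that always leave a fresh one. *)
Definition generating s := [forall X : {set 'Z_b},
  [&& X \subset Zp_units, 1 \in X & X != Zp_units] ==>
  (#|Zp_units| < count (fun p => ~~ stabilizes X p%:R) s)%N].

(* While [covered t] is a proper subset of the units, some prime of s outside t
   does not stabilize it, and adding this prime to t enlarges [covered t]. *)
Lemma generating_cover s : uniq s -> all (coprime b) s -> generating s ->
  exists t, [/\ uniq t, {subset t <= s}, (size t <= #|Zp_units|)%N & covered t = Zp_units].
Proof.
move=> us cs gs.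
suff H k : (k <= #|Zp_units|)%N -> exists t, [/\ uniq t, {subset t <= s}, (size t <= k)%N &
    covered t = Zp_units \/ (k < #|covered t|)%N].
  have [t [ut ts st [ct|ct]]] := H _ (leqnn _); first by exists t.
  exists t; split => //; have /covered_unit/subset_leq_card : all (coprime b) t.
    by apply/allP => p /ts; exact: (allP cs).
  by rewrite leqNgt ct.
elim: k => [|k IH] kU.
  by exists [::]; split => //; right; apply/card_gt0P; exists 1; exact: one_covered.
have [t [ut ts st [ct|ct]]] := IH (ltnW kU).
  by exists t; split => //; [exact: leqW|left].
have [cU|cU] := eqVneq (covered t) Zp_units; first by exists t; split => //; [exact: leqW|left].
have ctU : covered t \subset Zp_units.
  by apply: covered_unit; apply/allP => p /ts; exact: (allP cs).
have /forallP/(_ (covered t)) := gs; rewrite ctU one_covered cU /= => big.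
have [p ps pt] : exists2 p, p \in s & (p \notin t) && ~~ stabilizes (covered t) p%:R.
  apply/hasP; apply: contraLR big; rewrite -all_predC -leqNgt => /allP h.
  apply: (leq_trans _ (leq_trans st (ltnW kU))); rewrite -size_filter.
  apply: uniq_leq_size; first exact: filter_uniq.
  by move=> p; rewrite mem_filter => /andP[sp /h /=]; rewrite sp andbT negbK.
move: pt => /andP[pt /forall_inPn[x xt px]].
exists (p :: t); split => //=; first by rewrite pt.
  by move=> q; rewrite inE => /predU1P[->//|/ts].
right; apply: (leq_ltn_trans ct); apply/proper_card/properP; split; first exact: covered_sub_cons.
by exists (p%:R * x) => //; apply/covered_consP; exists 1%N, x; rewrite expr1.
Qed.

(** Whatever exponents the primes of s receive, the class still missing is a unit and is supplied by
    t. *)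
Lemma count_square_divisors_ge s t : covered t = Zp_units -> all (coprime b) s ->
  forall r : 'Z_b, r \is a GRing.unit ->
  (3 ^ size s <= count (fun e => e%:R == r) (square_divisors (s ++ t)))%N.
Proof.
move=> ct; elim: s => [_ r rU|p s IH /= /andP[bp cs] r rU].
  have : r \in covered t by rewrite ct inE.
  by rewrite inE expn0 -has_count => /mapP[e es ->]; apply/hasP; exists e.
have pU : (p%:R : 'Z_b) \is a GRing.unit by rewrite unitZpE.
rewrite cats0 !count_cat !count_map expnS.
have step i : (3 ^ size s <= count (preim (fun e => p ^ i * e)%N (fun e => e%:R == r))
    (square_divisors (s ++ t)))%N.
  apply: leq_trans (IH cs ((p%:R ^+ i)^-1 * r) _) _; last first.
    apply: sub_count => e /= /eqP E; rewrite natrM natrX E mulVKr ?unitrX//.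
  by rewrite unitrM unitrV unitrX.
by rewrite !mulSn mul0n addn0; apply: leq_add (step 0%N) (leq_add (step 1%N) (step 2%N)).
Qed.

(** The covering primes t are moved to the end of s and the target class is - D. At most #|Zp_units|
    exponents are sacrificed. *)
Lemma size_le_repr_count s a n : (0 < a)%N -> (a %| b)%N -> (0 < n)%N ->
    uniq s -> all prime s -> all (coprime b) s -> all (dvdn^~ n) s -> generating s ->
  (3 ^ size s <= 3 ^ #|Zp_units| * repr_count n a)%N.
Proof.
move=> a0 ab n0 us ps cs ds /(generating_cover us cs)[t [ut ts st ct]].
pose s' := [seq p <- s | p \notin t] ++ t.
have ss' : perm_eq s s'.
  rewrite -(perm_filterC (mem t) s) perm_catC perm_cat2l; apply: uniq_perm => //.
    exact: filter_uniq.
  by move=> p; rewrite mem_filter; apply: andb_idr => /ts.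
have allE (Q : pred nat) : all Q s -> all Q s' by rewrite (perm_all _ ss').
have := size_residue_divisors_le a0 b_gt1 ab n0 (etrans (esym (perm_uniq ss')) us)
  (allE _ ps) (allE _ cs) (allE _ ds).
have dU : (- (\prod_(p <- s') p)%N%:R : 'Z_b) \is a GRing.unit.
  rewrite unitrN natr_prod big_seq; apply: rpred_prod => p /(allP (allE _ cs)).
  by rewrite unitZpE.
have cs' : all (coprime b) [seq p <- s | p \notin t].
  by apply/allP => p; rewrite mem_filter => /andP[_ /(allP cs)].
have := count_square_divisors_ge ct cs' dU.
rewrite /residue_divisors size_filter -/s'.
have -> : count (fun e => e%:R == - (\prod_(p <- s') p)%N%:R :> 'Z_b) (square_divisors s') =
   count (fun e => (\prod_(p <- s') p)%N%:R + e%:R == 0 :> 'Z_b) (square_divisors s').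
  by apply: eq_count => e; rewrite addrC addr_eq0.
move=> h1 h2; rewrite (perm_size ss') size_cat expnD mulnC.
by rewrite leq_mul ?leq_exp2l// (leq_trans h1).
Qed.

End Covering.

(** * Primes outside a proper submonoid of the units *)

Section Divergence.
Context {R : realType}.
Variable b : nat.
Hypothesis b_gt1 : (1 < b)%N.
Variable K : pred 'Z_b.
Hypothesis K1 : K 1.
Hypothesis KM : forall x y, K x -> K y -> K (x * y).

Let Q p := [&& prime p, coprime b p & ~~ K p%:R].

Lemma submonoid_natr n : (0 < n)%N -> (forall p, prime p -> (p %| n)%N -> K p%:R) -> K n%:R.
Proof.
have [k] := ubnP n; elim: k n => // k IH n nk n0 h.
have [n1|n1] := leqP n 1; first by have -> : n = 1%N by lia.
have pp := pdiv_prime n1; have pn := pdiv_dvd n.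
rewrite -(divnK pn) natrM; apply: KM; last exact: h.
apply: IH; last by move=> q qp qn; apply: h => //; apply: (dvdn_trans qn); exact: dvdn_div.
  exact: leq_trans (ltn_Pdiv (prime_gt1 pp) n0) nk.
by rewrite divn_gt0 ?pdiv_gt0// dvdn_leq.
Qed.

(** 1 - 1/p >= e^(- 2/p), because (1 + 2x) (1 - x) >= 1 for 0 <= x <= 1/2. *)
Lemma totient_prod_primes_ge (s : seq nat) : uniq s -> all prime s ->
  expR (- (2 * \sum_(p <- s) p%:R^-1)) * (\prod_(p <- s) p)%N%:R <=
  (totient (\prod_(p <- s) p))%:R :> R.
Proof.
elim: s => [|p s IH] /=; first by rewrite !big_nil mulr0 oppr0 expR0 mul1r.
move=> /andP[ps us] /andP[pp ap]; rewrite !big_cons.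
rewrite totient_coprime ?coprime_prod_primes// totient_prime// !natrM mulrDr opprD expRD.
rewrite mulrACA; apply: ler_pM => //; rewrite ?mulr_ge0 ?expR_ge0//; last exact: IH.
have p2 : 2 <= p%:R :> R by rewrite ler_nat prime_gt1.
have p0 : 0 < p%:R :> R by lra.
rewrite expRN ler_pdivrMl ?expR_gt0//.
have e := expR_ge1Dx (2 * p%:R^-1 : R).
have -> : p.-1%:R = p%:R - 1 :> R by rewrite -subn1 natrB// prime_gt0.
have p1 : 0 <= p%:R - 1 :> R by lra.
apply: le_trans (ler_wpM2r p1 e).
rewrite mulrDl mul1r mulrBr mulr1 -mulrA mulVf ?gt_eqF// mulr1.
have : 2 * p%:R^-1 <= 1 :> R by rewrite ler_pdivrMr// mul1r.
lra.
Qed.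

Variable r : 'Z_b.
Hypotheses (r_unit : r \is a GRing.unit) (rK : ~~ K r).

(* The integers n < b P with n = r mod b and n coprime to P, where P is the
   product of the elements of Q below y, each have a prime factor in Q, at
   least y; there are totient P of them. *)
Lemma totient_le_tail (y : nat) (P := (\prod_(0 <= p < y | Q p) p)%N) X : (b * P <= X)%N ->
  (totient P)%:R <= (b * P)%:R * \sum_(y <= q < X | Q q) q%:R^-1 :> R.
Proof.
move=> bX.
have P0 : (0 < P)%N by rewrite prodn_cond_gt0// => p /andP[/prime_gt0].
have cbP : coprime b P.
  rewrite /P; apply: (big_ind (coprime b)) => [|u v hu hv|p /and3P[]//]; first exact: coprimen1.
  by rewrite coprimeMr hu.
(* The Chinese remainder lift: r mod b and m mod P, reduced below b P. *)
pose f m := (chinese b P (val r) m %% (b * P))%N.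
have f_lt m : (f m < b * P)%N by rewrite ltn_mod muln_gt0 P0 ltnW.
have f_b m : (f m)%:R = r.
  rewrite -(Zp_nat_mod b_gt1) /f modn_dvdm ?dvdn_mulr// chinese_modl// Zp_nat_mod//.
  exact: natr_Zp.
have f_P m : f m = m %[mod P] by rewrite /f modn_dvdm ?dvdn_mull// chinese_modr.
have f_gt0 m : (0 < f m)%N.
  have : coprime b (f m) by rewrite -unitZpE// f_b.
  by case: (f m) => //; rewrite /coprime gcdn0; lia.
have f_big m : coprime P m -> exists q, [/\ Q q, (y <= q < X)%N & (q %| f m)%N].
  move=> cPm.
  have cb : coprime b (f m) by rewrite -unitZpE// f_b.
  have [q [qp qf qK]] : exists q, [/\ prime q, (q %| f m)%N & ~~ K q%:R].
    apply: contrapT => h; move: rK; rewrite -(f_b m) => /negP; apply.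
    apply: submonoid_natr => // p pp pf; apply: contrapT => /negP pK.
    by apply: h; exists p.
  have Qq : Q q by rewrite /Q qp qK (coprime_dvdr qf cb).
  exists q; split => //; apply/andP; split; last first.
    by apply: leq_trans bX; apply: leq_ltn_trans (f_lt m); exact: dvdn_leq.
  rewrite leqNgt; apply/negP => qy.
  have qP : (q %| P)%N.
    by rewrite /P (big_rem q) ?mem_index_iota//= Qq dvdn_mulr.
  have : coprime P (f m) by rewrite -coprime_modr f_P coprime_modr.
  move=> /(coprime_dvdl qP); rewrite prime_coprime// qf.
  by [].
pose L := [seq m <- iota 0 P | coprime P m].
pose Qs := [seq q <- index_iota y X | Q q].
have sL : (size L <= \sum_(q <- Qs) (b * P) %/ q)%N.
  rewrite -(size_map f).
  have -> : (\sum_(q <- Qs) (b * P) %/ q)%N =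
      size [seq (q * k)%N | q <- Qs, k <- iota 1 ((b * P) %/ q)].
    rewrite size_allpairs_dep sumnE big_map.
    by apply: eq_bigr => q _; rewrite size_iota.
  apply: uniq_leq_size.
    rewrite map_inj_in_uniq ?filter_uniq ?iota_uniq// => m1 m2.
    rewrite !mem_filter !mem_iota => /andP[_ m1P] /andP[_ m2P] E.
    by rewrite -(modn_small m1P) -(modn_small m2P) -f_P E f_P.
  move=> n /mapP[m]; rewrite mem_filter => /andP[/f_big[q [Qq qX /dvdnP[k fE]]] _] ->.
  have := f_gt0 m; rewrite fE muln_gt0 => /andP[k0 q0].
  apply/allpairsPdep; exists q, k; rewrite mem_filter Qq mem_index_iota qX mem_iota k0.
  split; rewrite // ?[(k * q)%N]mulnC//=.
  by rewrite add1n ltnS leq_divRL// -fE ltnW.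
have <- : size L = totient P.
  by rewrite totient_count_coprime /index_iota subn0 size_filter -sum1_count big_mkcond.
apply: (@le_trans _ _ (\sum_(q <- Qs) (b * P) %/ q)%N%:R); first by rewrite ler_nat.
rewrite natr_sum mulr_sumr big_filter; apply: ler_sum => q _; exact: natr_divn_le.
Qed.

Lemma recip_sum_unbounded (M : R) : exists X, M < \sum_(0 <= p < X | Q p) p%:R^-1.
Proof.
apply: contrapT => h.
pose u X : R := \sum_(0 <= p < X | Q p) p%:R^-1.
have ub X : u X <= M by rewrite leNgt; apply/negP => uM; apply: h; exists X.
have nd : nondecreasing_seq u by apply: nondecreasing_series => n _ _; rewrite invr_ge0.
have cu : cvgn u by apply: nondecreasing_is_cvgn => //; exists M => _ [n _ <-].
have uX X := nondecreasing_cvgn_le nd cu X.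
(* With a tail of at most eps beyond y, the totient of P is at most b P eps = e^(- 2 M) P / 2, half
   of its lower bound e^(- 2 M) P. *)
pose eps := expR (- (2 * M)) / (2 * b%:R) : R.
have b0 : 0 < b%:R :> R by rewrite ltr0n ltnW.
have eps0 : 0 < eps by rewrite divr_gt0 ?expR_gt0// mulr_gt0.
have [y uy] : exists y, limn u - eps < u y.
  have : \forall n \near \oo, limn u - eps < u n.
    by apply: (cvgr_gt (limn u)) => //; rewrite ltrBlDr ltrDl.
  by case=> n _ /(_ n (leqnn n)) /=; exists n.
pose P := (\prod_(0 <= p < y | Q p) p)%N.
have P0 : (0 < P)%N by rewrite prodn_cond_gt0// => p /andP[/prime_gt0].
have h1 := totient_le_tail (leq_maxr y (b * P)%N).
have h2 : expR (- (2 * M)) * P%:R <= (totient P)%:R :> R.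
  have := @totient_prod_primes_ge [seq p <- index_iota 0 y | Q p] _ _.
  rewrite !big_filter -/P -/(u y) => h2.
  apply: le_trans (h2 _ _).
  - by rewrite ler_wpM2r// ler_expR lerN2 ler_pM2l// ub.
  - by rewrite filter_uniq// iota_uniq.
  - by apply/allP => p; rewrite mem_filter => /andP[/and3P[]].
have h3 : \sum_(y <= q < maxn y (b * P) | Q q) q%:R^-1 <= eps :> R.
  have := uX (maxn y (b * P)); rewrite /u (@big_cat_nat _ _ _ y)//= ?leq_maxl// -/(u y).
  by move: uy; lra.
have : expR (- (2 * M)) * P%:R <= (b * P)%:R * eps.
  by apply: (le_trans h2); apply: (le_trans h1); rewrite ler_wpM2l.
have -> : (b * P)%:R * eps = 2^-1 * (expR (- (2 * M)) * P%:R).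
  by rewrite natrM /eps; field; rewrite gt_eqF.
have : 0 < expR (- (2 * M)) * P%:R by rewrite mulr_gt0 ?expR_gt0// ltr0n.
lra.
Qed.

End Divergence.

(** * Integers with few prime factors in a given set, and the lower bound for almost all n *)

Section TypicalIntegers.
Context {R : realType}.

Lemma few_prime_factors_density (Q : pred nat) (C : nat) :
    (forall p, Q p -> prime p) ->
    (forall M : R, exists X, M < \sum_(0 <= p < X | Q p) p%:R^-1) ->
  forall eps : R, 0 < eps -> \forall N \near \oo,
    (\sum_(1 <= n < N.+1) (count Q (primes n) <= C)%N)%:R <= eps * N%:R.
Proof.
move=> Qp unb eps eps0.
(* A mass lam >= 2 C gives lam - C >= lam / 2, so Chebyshev's bound 2 lam / (lam - C)^2 is at most 8
   / lam <= eps. *)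
have [X hX] := unb (2 * C%:R + 1 + 8 / eps).
pose P : {set 'I_X} := [set p : 'I_X | Q p]%SET.
have PE : \sum_(p in P) p%:R^-1 = \sum_(0 <= p < X | Q p) p%:R^-1 :> R.
  by rewrite big_mkord; apply: eq_bigl => p; rewrite inE.
have Pp p : p \in P -> prime p by rewrite inE => /Qp.
near=> N.
have N0 : (0 < N)%N by near: N; exact: nbhs_infty_gt.
have NR0 : 0 < N%:R :> R by rewrite ltr0n.
have NP : (2 * #|P| <= N)%N by near: N; exact: nbhs_infty_ge.
have e8 : 0 < 8 / eps by rewrite divr_gt0.
have C0 : 0 <= C%:R :> R by [].
have Clam : C%:R < \sum_(p in P) p%:R^-1 :> R by rewrite PE; lra.
have := omega_in_le_small Pp N0 Clam; rewrite PE; set lam := \sum_(_ <= _ < _ | _) _ in hX *.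
move=> h; rewrite -ler_pdivrMr//.
apply: (@le_trans _ _ ((\sum_(1 <= n < N.+1) (omega_in P n <= C)%N)%:R / N%:R)).
  rewrite ler_pM2r ?invr_gt0// ler_nat big_nat_cond [leqRHS]big_nat_cond.
  apply: leq_sum => n /andP[/andP[n0 _] _].
  case: (leqP (count _ _) _) => // cn; rewrite (leq_trans _ cn)//.
  rewrite /omega_in cardE -(size_map val) -size_filter.
  apply: uniq_leq_size; first by rewrite map_inj_uniq ?enum_uniq//; exact: val_inj.
  move=> x /mapP[p]; rewrite mem_enum !inE => /andP[Qpp pn] ->.
  by rewrite mem_filter Qpp mem_primes Qp//= n0.
apply: (le_trans h).
have lC : 0 < lam - C%:R by lra.
rewrite ler_pdivrMr ?exprn_gt0//.
have q1 : 2 * (#|P|%:R / N%:R) <= 1 :> R.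
  by rewrite mulrA ler_pdivrMr// mul1r -natrM ler_nat.
have lam8 : 8 <= eps * lam by rewrite mulrC -ler_pdivrMr//; lra.
have lam2 : lam <= 2 * (lam - C%:R) by lra.
have lam0 : 0 < lam by lra.
apply: (@le_trans _ _ (lam * 2)); first by rewrite ler_wpM2l ?(ltW lam0)//; lra.
have : lam ^+ 2 <= 4 * (lam - C%:R) ^+ 2.
  have -> : 4 * (lam - C%:R) ^+ 2 = (2 * (lam - C%:R)) ^+ 2 by ring.
  by rewrite ler_sqr// nnegrE; lra.
move=> /(ler_wpM2l (ltW eps0)) h1.
have h2 : 8 * lam <= eps * lam ^+ 2 by rewrite expr2 mulrA ler_wpM2r// ltW.
by move: h1 h2; move: ((lam - C%:R) ^+ 2) (lam ^+ 2) => z1 z2; lra.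
Unshelve. all: by end_near. Qed.

(** If the greedy choice fails, one of finitely many sets X is to blame, and each is to blame with
    density 0. The modulus 2 a exceeds 1 even for a = 1, so ['Z_b] is the ring of integers mod b. *)
Lemma repr_count_lower a : (0 < a)%N -> exists C : nat,
  forall eps : R, 0 < eps -> \forall N \near \oo,
    (\sum_(1 <= n < N.+1)
      ~~ (3 ^ count (coprime (2 * a)) (primes n) <= 3 ^ C * repr_count n a)%N)%:R <= eps * N%:R.
Proof.
move=> a0; set b := (2 * a)%N; have b1 : (1 < b)%N by rewrite /b; lia.
exists #|Zp_units b| => eps eps0.
pose proper_cover := [set X : {set 'Z_b} | [&& X \subset Zp_units b, 1 \in X & X != Zp_units b]]%SET.
pose Q (X : {set 'Z_b}) p := [&& prime p, coprime b p & ~~ stabilizes X p%:R].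
have div X : X \in proper_cover -> forall e : R, 0 < e -> \forall N \near \oo,
    (\sum_(1 <= n < N.+1) (count (Q X) (primes n) <= #|Zp_units b|)%N)%:R <= e * N%:R.
  rewrite inE => /and3P[XU X1 XnU]; apply: few_prime_factors_density => [p /and3P[]//|M].
  have [r rU rX] : exists2 r, r \in Zp_units b & r \notin X.
    by apply/fintype.subsetPn; apply: contra XnU => UX; rewrite finset.eqEsubset XU.
  (* The stabilizer of X is a submonoid; since 1 is in X, a unit r outside X does not stabilize
     it. *)
  apply: (@recip_sum_unbounded _ _ b1 (stabilizes X)).
  - by apply/forall_inP => x; rewrite mul1r.
  - move=> x y /forall_inP hx /forall_inP hy; apply/forall_inP => z zX.
    by rewrite -mulrA hx// hy.
  - by move: rU; rewrite inE; exact: id.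
  - by apply/negP => /forall_inP/(_ 1 X1); rewrite mulr1 (negbTE rX).
pose k := #|proper_cover|.
have e'0 : 0 < eps / k.+1%:R by rewrite divr_gt0.
have {}div : \forall N \near \oo, forall X : {set 'Z_b}, X \in proper_cover ->
    (\sum_(1 <= n < N.+1) (count (Q X) (primes n) <= #|Zp_units b|)%N)%:R <= eps / k.+1%:R * N%:R.
  apply: filter_forall => X; have [Xp|Xp] := boolP (X \in proper_cover).
    by apply: filterS (div X Xp _ e'0).
  exact: nearW.
apply: filterS div => N div.
apply: (@le_trans _ _ (\sum_(X in proper_cover)
    \sum_(1 <= n < N.+1) (count (Q X) (primes n) <= #|Zp_units b|)%N)%N%:R).
  rewrite ler_nat exchange_big /= big_nat_cond [leqRHS]big_nat_cond.
  apply: leq_sum => n /andP[/andP[n0 _] _].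
  case: (boolP (3 ^ _ <= _)%N) => //= /negP bad.
  pose s := [seq p <- primes n | coprime b p].
  have /forallPn[X] : ~~ generating b s.
    apply/negP => gs; apply: bad; rewrite -size_filter -/s.
    apply: (size_le_repr_count b1 a0) => //; first exact: dvdn_mull.
    - by rewrite filter_uniq// primes_uniq.
    - by apply/allP => p; rewrite mem_filter mem_primes => /and3P[].
    - by apply/allP => p; rewrite mem_filter => /andP[].
    - by apply/allP => p; rewrite mem_filter mem_primes => /and4P[].
  rewrite negb_imply -leqNgt => /andP[Xp few].
  rewrite (bigD1 X) ?inE//= (_ : (count (Q X) _ <= _)%N) ?leq_addr//.
  apply: leq_trans few; rewrite /s count_filter; apply: eq_leq.
  apply: eq_in_count => p; rewrite mem_primes /Q /= => /andP[-> _] /=.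
  by rewrite andbC.
rewrite natr_sum; apply: (@le_trans _ _ (\sum_(X in proper_cover) eps / k.+1%:R * N%:R)).
  by apply: ler_sum.
rewrite sumr_const -/k -[_ *+ k]mulr_natl mulrA ler_wpM2r// mulrCA ler_piMr ?(ltW eps0)//.
by rewrite ler_pdivrMr// mul1r ler_nat.
Qed.

End TypicalIntegers.

(** * The truncated prime factor count *)

Section ErdosKac.
Context {R : realType}.

Definition loglog N : R := ln (ln N%:R).
(** The successor rounds up, so that the sum of 1/p^2 over larger p is at most 1 / log^3 N. *)
Definition sieve_low N := (Num.truncn (ln (N%:R : R) ^+ 3)).+1.
Definition sieve_high N := (Num.truncn (expR (ln N%:R / (20 * loglog N)))).+1.
Definition sieve_primes N : {set 'I_N.+1} :=
  [set p : 'I_N.+1 | prime p && (sieve_low N < p <= sieve_high N)%N]%SET.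
Definition sieve_mass N : R := \sum_(p in sieve_primes N) p%:R^-1.

Lemma cvg_loglog : loglog N @[N --> \oo] --> +oo.
Proof.
apply/cvgryPge => A; near=> N.
have h : expR (expR A) <= N%:R by near: N; exact: (cvgry_ge cvgr_idn).
have N0 : 0 < N%:R :> R by apply: lt_le_trans h; exact: expR_gt0.
have h1 : expR A <= ln N%:R by rewrite -ler_expR lnK ?posrE.
by rewrite /loglog -ler_expR lnK// posrE (lt_le_trans (expR_gt0 A)).
Unshelve. all: by end_near. Qed.

(* The parameters are powers of log log N and log N = e ^ log log N, compared for log log N >= 50. *)
Variant sieve_spec N : Prop := SieveSpec of
  (0 < N)%N & N%:R = expR (expR (loglog N)) :> R & 50 <= loglog N &
  (1 < sieve_low N)%N & (sieve_low N <= sieve_high N)%N & (sieve_high N <= N)%N &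
  expR (loglog N) ^+ 3 <= (sieve_low N)%:R & (sieve_low N)%:R <= expR (4 * loglog N) &
  expR (expR (loglog N) / (20 * loglog N)) <= (sieve_high N)%:R &
  (sieve_high N)%:R <= 2 * expR (expR (loglog N) / (20 * loglog N)).

Lemma expR_ge_sqr (l : R) : 50 <= l -> 80 * l ^+ 2 <= expR l.
Proof.
move=> l5; have l0 : 0 <= l by lra.
have h := expR_ge1Dxn 3 l0; rewrite (_ : 4`!%:R = 24) in h; last by [].
have {}h : l ^+ 4 / 24 <= expR l by apply: le_trans h; rewrite lerDr.
apply: (le_trans _ h); rewrite ler_pdivlMr//.
have -> : l ^+ 4 = l ^+ 2 * l ^+ 2 by ring.
rewrite mulrAC ler_wpM2r ?sqr_ge0//.
have -> : 80 * 24 = 40 * 48 :> R by ring.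
by rewrite expr2; nra.
Qed.

Lemma loglog_threshold (l : R) : 50 <= l -> 4 * l <= expR l / (20 * l).
Proof.
move=> l5; have h := expR_ge_sqr l5; have l0 : 0 < 20 * l by lra.
rewrite ler_pdivlMr//.
have -> : 4 * l * (20 * l) = 80 * l ^+ 2 by ring.
exact: h.
Qed.

Lemma sieveP : \forall N \near \oo, sieve_spec N.
Proof.
near=> N; have l5 : 50 <= loglog N by near: N; exact: (cvgry_ge cvg_loglog).
have N0 : (0 < N)%N by near: N; exact: nbhs_infty_gt.
have N0R : 0 < N%:R :> R by rewrite ltr0n.
have L0 : 0 < ln (N%:R : R).
  rewrite ltNge; apply/negP => L0; move: l5; rewrite /loglog ln0//; lra.
have LE : ln (N%:R : R) = expR (loglog N) by rewrite lnK.
have NE : N%:R = expR (expR (loglog N)) :> R by rewrite -LE lnK.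
have el1 : 1 < expR (loglog N) by rewrite expR_gt1; lra.
have el2 : 2 <= expR (loglog N) by have := expR_ge1Dx (loglog N); lra.
have low_ge : expR (loglog N) ^+ 3 <= (sieve_low N)%:R.
  rewrite /sieve_low LE; apply: ltW; exact: truncnS_gt.
have low_le : (sieve_low N)%:R <= expR (4 * loglog N).
  rewrite /sieve_low LE -natr1.
  have : (Num.truncn (expR (loglog N) ^+ 3))%:R <= expR (loglog N) ^+ 3.
    by rewrite truncn_le exprn_ge0// expR_ge0.
  rewrite expRM_natl.
  have : 1 <= expR (loglog N) ^+ 3 by rewrite exprn_ege1// ltW.
  move: (Num.truncn _) el2 => t; rewrite [_ ^+ 4]exprS.
  by move: (expR _) (expR _ ^+ 3) => E E3; clear; nra.
have hi_ge : expR (expR (loglog N) / (20 * loglog N)) <= (sieve_high N)%:R.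
  rewrite /sieve_high LE; apply: ltW; exact: truncnS_gt.
have q1 := loglog_threshold l5.
have hi_le : (sieve_high N)%:R <= 2 * expR (expR (loglog N) / (20 * loglog N)).
  rewrite /sieve_high LE -natr1.
  have : (Num.truncn (expR (expR (loglog N) / (20 * loglog N))))%:R <=
      expR (expR (loglog N) / (20 * loglog N)) by rewrite truncn_le expR_ge0.
  have : 1 <= expR (expR (loglog N) / (20 * loglog N)).
    by rewrite -[leLHS]expR0 ler_expR; apply: le_trans q1; lra.
  by move: (Num.truncn _) => t; move: (expR (expR _ / _)) => E; clear; lra.
have low1 : (1 < sieve_low N)%N.
  have h3 : expR (loglog N) <= expR (loglog N) ^+ 3 by rewrite ler_eXnr// ltW.
  by rewrite -(ltr_nat R); apply: lt_le_trans low_ge; apply: lt_le_trans h3.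
have lowhi : (sieve_low N <= sieve_high N)%N.
  by rewrite -(ler_nat R) (le_trans low_le)// (le_trans _ hi_ge)// ler_expR.
have hiN : (sieve_high N <= N)%N.
  rewrite -(ler_nat R) (le_trans hi_le)// NE.
  have q2 : expR (loglog N) / (20 * loglog N) <= expR (loglog N) / 2.
    by rewrite ler_wpM2l ?expR_ge0// lef_pV2 ?posrE; lra.
  have {}q2 : expR (expR (loglog N) / (20 * loglog N)) <= expR (expR (loglog N) / 2).
    by rewrite ler_expR.
  have -> : expR (expR (loglog N)) = expR (expR (loglog N) / 2) * expR (expR (loglog N) / 2).
    by rewrite -expRD; congr expR; field.
  have := expR_ge1Dx (expR (loglog N) / 2).
  by move: (expR (expR (loglog N) / 2)) q2 => E q2 h; nra.
exact: SieveSpec.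
Unshelve. all: by end_near. Qed.

Lemma big_sieve_primes N (F : nat -> R) : (sieve_low N <= sieve_high N <= N)%N ->
  \sum_(p in sieve_primes N) F p =
  \sum_((sieve_low N).+1 <= p < (sieve_high N).+1 | prime p) F p.
Proof.
move=> /andP[lh hN].
under eq_bigl do rewrite inE.
rewrite -(big_mkord (fun p => prime p && (sieve_low N < p <= sieve_high N)%N)).
rewrite big_mkcond (@big_cat_nat _ _ _ (sieve_low N).+1)//=; last by rewrite ltnS (leq_trans lh).
rewrite [X in X + _]big_nat_cond [X in X + _]big1 ?add0r; last first.
  by move=> p /andP[/andP[_ pl] _]; rewrite ltnNge -ltnS pl andbF.
rewrite (@big_cat_nat _ _ _ (sieve_high N).+1)//= [X in _ + X]big_nat_cond [X in _ + X]big1 ?addr0; last first.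
  by move=> p /andP[/andP[pl _] _]; rewrite [(p <= _)%N]leqNgt pl !andbF.
rewrite [RHS]big_mkcond /= big_nat_cond [RHS]big_nat_cond; apply: eq_bigr => p.
by move=> /andP[/andP[h1 h2] _]; rewrite h1 -[(p <= _)%N]ltnS h2 /= andbT.
Qed.

Lemma sum_inv_sqr_le w m : (0 < w)%N -> (w <= m)%N ->
  \sum_(w.+1 <= n < m.+1) (n%:R^-1) ^+ 2 <= w%:R^-1 - m%:R^-1 :> R.
Proof.
move=> w0; elim: m => [|m IH]; first by case: w w0.
rewrite leq_eqVlt => /predU1P[<-|wm]; first by rewrite big_geq// subrr.
rewrite big_nat_recr//=; have := IH wm; move: (\sum_(_ <= _ < _) _) => S hS.
have m0 : 0 < m%:R :> R by rewrite ltr0n (leq_trans w0).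
have m1 : m.+1%:R = m%:R + 1 :> R by rewrite -natr1.
suff : m.+1%:R^-1 ^+ 2 <= m%:R^-1 - m.+1%:R^-1 :> R.
  by move: (m.+1%:R^-1) => v h; lra.
rewrite m1; have -> : m%:R^-1 - (m%:R + 1)^-1 = (m%:R * (m%:R + 1))^-1 :> R.
  by field; rewrite !gt_eqF// ltr_pwDl.
rewrite exprVn lef_pV2 ?posrE ?exprn_gt0 ?mulr_gt0// ?ltr_pwDl// expr2.
by rewrite ler_wpM2r ?lerDl// addr_ge0// ltW.
Qed.

Lemma ln_le_root4 (x : R) : 0 < x -> ln x <= 4 * Num.sqrt (Num.sqrt x).
Proof.
move=> x0; set q := Num.sqrt _.
have q0 : 0 < q by rewrite !sqrtr_gt0.
have -> : x = q ^+ 4 by rewrite (exprM q 2 2) !sqr_sqrtr ?sqrtr_ge0 ?(ltW x0).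
rewrite lnXn// -[_ *+ 4]mulr_natl ler_wpM2l//.
by apply: (le_trans (ln_le_sub1 q0)); rewrite gerBl.
Qed.

(** 12 = 4 * 3, where 3 bounds the fourth root of 20. *)
Lemma ln20_le (l : R) : 1 <= l -> ln (20 * l) <= 12 * Num.sqrt (Num.sqrt l).
Proof.
move=> l1; apply: (le_trans (ln_le_root4 _)); first by lra.
rewrite [12 * _](_ : _ = 4 * (3 * Num.sqrt (Num.sqrt l))); last by ring.
rewrite ler_wpM2l// sqrtrM// sqrtrM ?sqrtr_ge0// ler_wpM2r ?sqrtr_ge0//.
have s3 (x : R) : 0 <= x -> x = Num.sqrt (x ^+ 2) by move=> x0; rewrite sqrtr_sqr ger0_norm.
rewrite [leRHS]s3// ler_wsqrtr// [leRHS]s3 ?sqr_ge0// ler_wsqrtr//.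
by rewrite !expr2; lra.
Qed.

(** Mertens at both ends of the window costs 2 C, and each end loses at most ln (20 log log N),
    hence 24 = 2 * 12. The upper bound is kept within O(1) because it is exponentiated in the error
    terms; the fourth root suffices for centering. *)
Lemma sieve_mass_bounds : exists2 D : R, 0 < D &
  \forall N \near \oo, sieve_mass N <= loglog N + D /\
    `|sieve_mass N - loglog N| <= D * Num.sqrt (Num.sqrt (loglog N)).
Proof.
have [C [C0 HC]] := @mertens_second R.
exists (24 + 2 * C); first by lra.
apply: filterS sieveP => N [N0 NE l5 low1 lowhi hiN low_ge low_le hi_ge hi_le].
have l0 : 0 < loglog N by clear -l5; lra.
have q1 : 1 <= Num.sqrt (Num.sqrt (loglog N)).
  by rewrite -[leLHS]sqrtr1 ler_wsqrtr// -[leLHS]sqrtr1 ler_wsqrtr//; clear -l5; lra.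
have massE : sieve_mass N = prime_recip_sum (sieve_high N) - prime_recip_sum (sieve_low N).
  rewrite /sieve_mass (big_sieve_primes (fun p => p%:R^-1)) ?lowhi//.
  rewrite /prime_recip_sum [X in _ = X - _](@big_cat_nat _ _ _ (sieve_low N).+1)//=.
  by rewrite [RHS]addrC addKr.
have hi1 : (1 < sieve_high N)%N by apply: leq_trans low1 lowhi.
have low0 : 0 < (sieve_low N)%:R :> R by rewrite ltr0n.
have hi0 : 0 < (sieve_high N)%:R :> R by rewrite ltr0n ltnW.
have := HC _ low1; have := HC _ hi1; rewrite !ler_norml => /andP[h1 h2] /andP[h3 h4].
have lnhi0 : 0 < ln (sieve_high N)%:R :> R by rewrite ln_gt0// ltr1n.
have lnlow0 : 0 < ln (sieve_low N)%:R :> R by rewrite ln_gt0// ltr1n.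
have hiub : ln (ln (sieve_high N)%:R) <= loglog N.
  rewrite /loglog ler_ln ?posrE//; last by rewrite NE expRK expR_gt0.
  by rewrite ler_ln ?posrE ?ltr0n// ler_nat.
have lowub : ln (ln (sieve_low N)%:R) <= ln (20 * loglog N).
  rewrite ler_ln ?posrE//; last by clear -l0; lra.
  rewrite -ler_expR lnK ?posrE// (le_trans low_le)// ler_expR.
  by clear -l0; lra.
have hilb : loglog N - ln (20 * loglog N) <= ln (ln (sieve_high N)%:R).
  rewrite -{1}(expRK (loglog N)) -ln_div ?posrE ?expR_gt0//; last by clear -l0; lra.
  have d0 : 0 < expR (loglog N) / (20 * loglog N).
    by rewrite divr_gt0 ?expR_gt0// mulr_gt0.
  by rewrite ler_ln ?posrE// -ler_expR lnK ?posrE.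
have l20 := @ln20_le (loglog N) _.
have {}l20 : ln (20 * loglog N) <= 12 * Num.sqrt (Num.sqrt (loglog N)).
  by apply: l20; clear -l5; lra.
have plow : 0 <= prime_recip_sum (sieve_low N) :> R.
  by apply: sumr_ge0 => p _; rewrite invr_ge0.
rewrite massE; move: (Num.sqrt (Num.sqrt _)) q1 l20 => q q1 l20.
have Cq : C <= C * q by rewrite ler_peMr// ltW.
split; first by clear -h2 hiub plow C0; lra.
apply/andP; split.
  by clear -h1 h4 hilb lowub l20 Cq q1; lra.
by clear -h2 hiub plow Cq q1 C0; lra.
Qed.

Definition sieve_cdf N m : R :=
  (\sum_(1 <= n < N.+1) (omega_in (sieve_primes N) n <= m)%N)%:R / N%:R.

Lemma card_sieve_primes_le N : (#|sieve_primes N| <= sieve_high N)%N.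
Proof.
rewrite cardE -(size_map val) -[leqRHS](size_iota 1); apply: uniq_leq_size.
  by rewrite map_inj_uniq ?enum_uniq//; exact: val_inj.
move=> x /mapP[p]; rewrite mem_enum inE => /and3P[/prime_gt0 p0 _ ph] ->.
by rewrite mem_iota p0 add1n ltnS.
Qed.

Lemma expR1_le4 : expR 1 <= 4 :> R.
Proof.
have h := expR_ge1Dx (- 2^-1 : R).
have p := expR_gt0 (2^-1 : R).
have e : expR (2^-1) * expR (- 2^-1) = 1 :> R by rewrite expRxMexpNx_1.
have -> : expR 1 = expR (2^-1) * expR (2^-1) :> R by rewrite -expRD; congr expR; field.
by move: h p e; move: (expR _) (expR _) => u v; nra.
Qed.

(** log^2 N from the exponential against 1 / log^3 N from the squares; the resulting 1 / log N is
    weakened to the form shared by the three errors. *)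
Lemma sieve_error_sqr N D : sieve_spec N -> sieve_mass N <= loglog N + D ->
  expR (2 * sieve_mass N) * (4 * \sum_(p in sieve_primes N) p%:R^-1 ^+ 2) <=
    4 * expR (2 * D) / loglog N.
Proof.
move=> [N0 NE l5 low1 lowhi hiN low_ge low_le hi_ge hi_le] mass_le.
have l0 : 0 < loglog N by clear -l5; lra.
have El : loglog N <= expR (loglog N) by have := expR_ge1Dx (loglog N); clear; lra.
have E0 := expR_gt0 (loglog N).
have k1 : \sum_(p in sieve_primes N) (p%:R : R)^-1 ^+ 2 <= expR (loglog N) ^- 3.
  rewrite (big_sieve_primes (fun p => (p%:R : R)^-1 ^+ 2)) ?lowhi//.
  apply: (@le_trans _ _ (sieve_low N)%:R^-1); last first.
    by rewrite lef_pV2 ?posrE ?exprn_gt0// ltr0n.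
  apply: (@le_trans _ _ ((sieve_low N)%:R^-1 - (sieve_high N)%:R^-1)); last first.
    by rewrite gerBl invr_ge0.
  apply: le_trans (sum_inv_sqr_le (ltn0Sn _) lowhi).
  rewrite big_mkcond; apply: ler_sum => p _.
  by case: ifP => // _; rewrite sqr_ge0.
have k2 : expR (2 * sieve_mass N) <= expR (loglog N) ^+ 2 * expR (2 * D).
  by rewrite -expRM_natl -expRD ler_expR; clear -mass_le; lra.
apply: (@le_trans _ _ (expR (loglog N) ^+ 2 * expR (2 * D) * (4 * expR (loglog N) ^- 3))).
  apply: ler_pM; rewrite ?expR_ge0//.
    by rewrite mulr_ge0// sumr_ge0// => p _; rewrite sqr_ge0.
  by rewrite ler_wpM2l.
have -> : expR (loglog N) ^+ 2 * expR (2 * D) * (4 * expR (loglog N) ^- 3) =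
    4 * expR (2 * D) / expR (loglog N) by field; rewrite gt_eqF.
by rewrite ler_wpM2l ?mulr_ge0 ?expR_ge0// lef_pV2 ?posrE.
Qed.

(** The exponent 1 / (20 log log N) of the window times T <= 10 log log N is at most 1/2, so the
    power is about sqrt N at most. *)
Lemma sieve_error_rounding N T : sieve_spec N -> T%:R <= 10 * loglog N ->
  T%:R * ((2 * sieve_high N)%:R ^+ T / N%:R) <= 10 / loglog N.
Proof.
move=> [N0 NE l5 low1 lowhi hiN low_ge low_le hi_ge hi_le] T10.
have l0 : 0 < loglog N by clear -l5; lra.
have El : loglog N <= expR (loglog N) by have := expR_ge1Dx (loglog N); clear; lra.
have e2 : 4 <= expR 2 :> R.
  have -> : expR 2 = expR 1 * expR 1 :> R by rewrite -expRD; congr expR; ring.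
  have := expR_ge1Dx (1 : R); move: (expR 1) => e; clear; nra.
have k1 : (2 * sieve_high N)%:R <= expR (2 + expR (loglog N) / (20 * loglog N)).
  rewrite natrM expRD; move: hi_le (expR_gt0 (expR (loglog N) / (20 * loglog N))).
  by move: (expR (_ / _)) => E; clear -e2; nra.
have k2 : (2 * sieve_high N)%:R ^+ T <= expR (20 * loglog N + expR (loglog N) / 2).
  apply: (@le_trans _ _ (expR (2 + expR (loglog N) / (20 * loglog N)) ^+ T)).
    by rewrite lerXn2r ?nnegrE ?expR_ge0.
  rewrite -expRM_natl ler_expR.
  apply: (@le_trans _ _ (10 * loglog N * (2 + expR (loglog N) / (20 * loglog N)))).
    by rewrite ler_wpM2r// addr_ge0// divr_ge0 ?expR_ge0// mulr_ge0// ltW.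
  by rewrite le_eqVlt; apply/orP; left; apply/eqP; field; rewrite gt_eqF.
have k3 : (2 * sieve_high N)%:R ^+ T / N%:R <= loglog N ^- 2.
  rewrite NE -expRN; apply: (@le_trans _ _ (expR (- (2 * loglog N)))).
    apply: (@le_trans _ _ (expR (20 * loglog N + expR (loglog N) / 2) * expR (- expR (loglog N)))).
      by rewrite ler_wpM2r ?expR_ge0.
    rewrite -expRD ler_expR; have := expR_ge_sqr l5; rewrite expr2.
    by move: (expR _) => E; clear -l5; nra.
  rewrite expRN lef_pV2 ?posrE ?exprn_gt0 ?expR_gt0// expRM_natl.
  by rewrite lerXn2r ?nnegrE ?expR_ge0// ltW.
apply: (@le_trans _ _ (10 * loglog N * loglog N ^- 2)).
  by apply: ler_pM => //; rewrite divr_ge0 ?exprn_ge0.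
by rewrite le_eqVlt; apply/orP; left; apply/eqP; field; rewrite gt_eqF.
Qed.

(** As 4 >= e, 4^T is at least log^9 N, one factor log N more than e^(8 mass) up to a constant. *)
Lemma sieve_error_tail N D T : sieve_spec N -> sieve_mass N <= loglog N + D ->
  9 * loglog N <= T%:R ->
  expR (8 * sieve_mass N) / 4 ^+ T <= expR (8 * D) / loglog N.
Proof.
move=> [N0 NE l5 low1 lowhi hiN low_ge low_le hi_ge hi_le] mass_le T9.
have l0 : 0 < loglog N by clear -l5; lra.
have El : loglog N <= expR (loglog N) by have := expR_ge1Dx (loglog N); clear; lra.
have E0 := expR_gt0 (loglog N).
have k1 : expR (8 * sieve_mass N) <= expR (8 * loglog N) * expR (8 * D).
  by rewrite -expRD ler_expR; clear -mass_le; lra.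
have k2 : expR (9 * loglog N) <= 4 ^+ T.
  apply: (@le_trans _ _ (expR 1 ^+ T)); last by rewrite lerXn2r ?nnegrE ?expR_ge0// expR1_le4.
  by rewrite -expRM_natl mulr1 ler_expR.
apply: (@le_trans _ _ (expR (8 * loglog N) * expR (8 * D) / expR (9 * loglog N))).
  apply: ler_pM => //; rewrite ?expR_ge0 ?invr_ge0 ?exprn_ge0//.
  by rewrite lef_pV2 ?posrE ?expR_gt0// exprn_gt0.
have -> : expR (9 * loglog N) = expR (8 * loglog N) * expR (loglog N).
  by rewrite -expRD; congr expR; ring.
have -> : expR (8 * loglog N) * expR (8 * D) / (expR (8 * loglog N) * expR (loglog N)) =
    expR (8 * D) / expR (loglog N) by field; rewrite !gt_eqF ?expR_gt0.
by rewrite ler_wpM2l ?expR_ge0// lef_pV2 ?posrE.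
Qed.

Lemma sieve_cdf_poisson : exists2 D : R, 0 < D &
  \forall N \near \oo, forall m,
    `|sieve_cdf N m - poisson_cdf (sieve_mass N) m| <= D / loglog N.
Proof.
have [D D0 HD] := sieve_mass_bounds.
exists (4 * expR (2 * D) + 10 + expR (8 * D)).
  by have := expR_gt0 (2 * D); have := expR_gt0 (8 * D); lra.
apply: (filterS _ (filterI sieveP HD)) => N [NS [mass_le _]] m.
case: (NS) => N0 _ l5 low1 lowhi _ _ _ _ _.
have l0 : 0 < loglog N by clear -l5; lra.
have Pp p : p \in sieve_primes N -> prime p by rewrite inE => /andP[].
have [T T9 T10] : exists2 T, 9 * loglog N <= T%:R & T%:R <= 10 * loglog N.
  exists (Num.truncn (9 * loglog N)).+1; first by apply: ltW; exact: truncnS_gt.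
  rewrite -natr1.
  have : (Num.truncn (9 * loglog N))%:R <= 9 * loglog N.
    by rewrite truncn_le; clear -l0; lra.
  by move: (Num.truncn _) => t; clear -l5; lra.
have hi0 : (0 < sieve_high N)%N by rewrite (leq_trans _ lowhi)// ltnW.
apply: (le_trans (@omega_in_poisson R _ _ Pp N T (sieve_high N) m N0 (card_sieve_primes_le N) hi0)).
have b1 := sieve_error_sqr NS mass_le.
have b2 := sieve_error_rounding NS T10.
have b3 := sieve_error_tail NS mass_le T9.
apply: (le_trans (lerD (lerD b1 b2) b3)).
by rewrite -2!mulrDl.
Qed.

Lemma cvg_sqrt_pinfty (f : nat -> R) : f N @[N --> \oo] --> +oo ->
  Num.sqrt (f N) @[N --> \oo] --> +oo.
Proof.
move=> fy; apply/cvgryPge => A; near=> N.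
rewrite (le_trans (ler_norm A))// -sqrtr_sqr ler_wsqrtr//.
by near: N; exact: cvgry_ge.
Unshelve. all: by end_near. Qed.

Lemma cvg_inv_pinfty (f : nat -> R) : f N @[N --> \oo] --> +oo ->
  (f N)^-1 @[N --> \oo] --> (0 : R).
Proof. by move=> fy; apply/gtr0_cvgV0 => //; exact: (cvgry_gt fy). Qed.

(** The threshold is rounded down to an integer m. The normal limit is stated with scale sqrt m, so
    m / log log N -> 1 is needed besides the centering. *)
Lemma cvg_sieve_cdf (z : R) :
  (\sum_(1 <= n < N.+1) ((omega_in (sieve_primes N) n)%:R <=
     loglog N + z * Num.sqrt (loglog N))%R)%:R / N%:R @[N --> \oo] --> Phi z.
Proof.
pose s N := Num.sqrt (loglog N); pose q N := Num.sqrt (s N).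
pose m N := Num.truncn (loglog N + z * s N).
have sy : s N @[N --> \oo] --> +oo by apply: cvg_sqrt_pinfty; exact: cvg_loglog.
have qy : q N @[N --> \oo] --> +oo by exact: cvg_sqrt_pinfty.
have [D D0 HD] := sieve_mass_bounds.
have [D' D'0 HD'] := sieve_cdf_poisson.
have l0 : \forall N \near \oo, 0 < loglog N by exact: (cvgry_gt cvg_loglog).
have lE N : 0 < loglog N -> loglog N = s N ^+ 2 by move=> ?; rewrite sqr_sqrtr// ltW.
have mi : \forall N \near \oo, [/\ 0 <= loglog N + z * s N,
    (m N)%:R <= loglog N + z * s N & loglog N + z * s N < (m N)%:R + 1].
  near=> N; have sz : `|z| <= s N by near: N; exact: cvgry_ge.
  have z0 : 0 <= loglog N + z * s N.
    rewrite lE; last by near: N.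
    by have := ler_norm (- z); rewrite normrN; have := normr_ge0 z; nra.
  by have /andP[h1 h2] := truncn_itv z0; split => //; rewrite natr1.
have my : m @ \oo --> \oo.
  apply/cvgnyPge => A; near=> N.
  have [z0 _ _] : [/\ 0 <= loglog N + z * s N,
    (m N)%:R <= loglog N + z * s N & loglog N + z * s N < (m N)%:R + 1] by near: N.
  rewrite truncn_ge_nat// lE; last by near: N.
  have sz : A%:R + 1 + `|z| <= s N by near: N; exact: cvgry_ge.
  have A0 : 0 <= A%:R :> R by [].
  by have := ler_norm (- z); rewrite normrN; have := normr_ge0 z; nra.
have s1 : (s N)^-1 @[N --> \oo] --> (0 : R) by exact: cvg_inv_pinfty.
have q1 : (q N)^-1 @[N --> \oo] --> (0 : R) by exact: cvg_inv_pinfty.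
have l1 : (loglog N)^-1 @[N --> \oo] --> (0 : R).
  by apply: cvg_inv_pinfty; exact: cvg_loglog.
have az : ((m N)%:R - sieve_mass N) / s N @[N --> \oo] --> z.
  (* Rounding costs 1 and the mass D q, both divided by s = q^2. *)
  have u0 : (s N)^-1 + D * (q N)^-1 @[N --> \oo] --> (0 : R).
    rewrite -[X in _ --> X](addr0 0) -{2}(mulr0 D); apply: cvgD => //.
    exact: cvgMl_tmp.
  apply: (@squeeze_cvgr _ _ _ _ (fun N => z - ((s N)^-1 + D * (q N)^-1))
                                (fun N => z + ((s N)^-1 + D * (q N)^-1))); last 2 first.
  - by rewrite -[X in _ --> X](subr0 z); apply: cvgB => //; exact: cvg_cst.
  - by rewrite -[X in _ --> X](addr0 z); apply: cvgD => //; exact: cvg_cst.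
  near=> N.
  have [_ hm] : sieve_mass N <= loglog N + D /\
    `|sieve_mass N - loglog N| <= D * q N by near: N.
  have [_ m1 m2] : [/\ 0 <= loglog N + z * s N,
    (m N)%:R <= loglog N + z * s N & loglog N + z * s N < (m N)%:R + 1] by near: N.
  have s0 : 0 < s N by near: N; exact: (cvgry_gt sy).
  have q0 : 0 < q N by rewrite sqrtr_gt0.
  have sq : s N = q N * q N by rewrite -expr2 sqr_sqrtr// ltW.
  rewrite ler_pdivlMr// ler_pdivrMr//.
  have e : ((s N)^-1 + D * (q N)^-1) * s N = 1 + D * q N.
    by rewrite mulrDl mulVf ?gt_eqF// sq mulrA mulfVK ?gt_eqF.
  rewrite mulrBl e mulrDl e; move: hm; rewrite ler_norml => /andP[hm1 hm2].
  by apply/andP; split; lra.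
have ml : (m N)%:R / loglog N @[N --> \oo] --> (1 : R).
  have u0 : `|z| * (s N)^-1 + (loglog N)^-1 @[N --> \oo] --> (0 : R).
    rewrite -[X in _ --> X](addr0 0) -{1}(mulr0 `|z|); apply: cvgD => //.
    exact: cvgMl_tmp.
  apply: (@squeeze_cvgr _ _ _ _ (fun N => 1 - (`|z| * (s N)^-1 + (loglog N)^-1))
                                (fun N => 1 + (`|z| * (s N)^-1 + (loglog N)^-1))); last 2 first.
  - by rewrite -[X in _ --> X](subr0 1); apply: cvgB => //; exact: cvg_cst.
  - by rewrite -[X in _ --> X](addr0 1); apply: cvgD => //; exact: cvg_cst.
  near=> N.
  have [_ m1 m2] : [/\ 0 <= loglog N + z * s N,
    (m N)%:R <= loglog N + z * s N & loglog N + z * s N < (m N)%:R + 1] by near: N.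
  have s0 : 0 < s N by near: N; exact: (cvgry_gt sy).
  have ll0 : 0 < loglog N by near: N.
  rewrite ler_pdivlMr// ler_pdivrMr//.
  have e : (`|z| * (s N)^-1 + (loglog N)^-1) * loglog N = `|z| * s N + 1.
    by rewrite mulrDl mulVf ?gt_eqF// (lE _ ll0); field; rewrite gt_eqF.
  rewrite mulrBl e mulrDl e mul1r.
  have h1 := ler_norm z; have h2 := ler_norm (- z); rewrite normrN in h2.
  by apply/andP; split; nra.
have bl : Num.sqrt ((m N)%:R / loglog N) @[N --> \oo] --> (1 : R).
  by rewrite -[X in _ --> X]sqrtr1; apply: continuous_cvg ml; exact: sqrt_continuous.
have cdfE : \forall N \near \oo, sieve_cdf N (m N) =
    (\sum_(1 <= n < N.+1) ((omega_in (sieve_primes N) n)%:R <=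
     loglog N + z * Num.sqrt (loglog N))%R)%:R / N%:R :> R.
  near=> N.
  have [z0 _ _] : [/\ 0 <= loglog N + z * s N,
    (m N)%:R <= loglog N + z * s N & loglog N + z * s N < (m N)%:R + 1] by near: N.
  congr (_%:R / _); apply: eq_bigr => n _; congr nat_of_bool.
  exact: truncn_ge_nat.
suff h : sieve_cdf N (m N) @[N --> \oo] --> Phi z.
  by apply: cvg_trans h; exact: near_eq_cvg.
have pn : poisson_cdf (sieve_mass N) (m N) @[N --> \oo] --> Phi z.
  apply: cvg_poisson_normal => //.
    by move=> N; apply: sumr_ge0 => p _; rewrite invr_ge0.
  have : (((m N)%:R - sieve_mass N) / s N) / Num.sqrt ((m N)%:R / loglog N)
      @[N --> \oo] --> z / 1.
    by apply: cvgM => //; apply: cvgV => //; rewrite oner_eq0.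
  rewrite divr1; apply: cvg_trans; apply: near_eq_cvg; near=> N.
  have ll0 : 0 < loglog N by near: N.
  have s0 : 0 < s N by near: N; exact: (cvgry_gt sy).
  have m0 : (0 < m N)%N by near: N; exact: (my _ (nbhs_infty_gt 0)).
  rewrite sqrtrM ?ler0n// sqrtrV ?(ltW ll0)// -/(s N).
  have : 0 < Num.sqrt (m N)%:R :> R by rewrite sqrtr_gt0 ltr0n.
  by move: (Num.sqrt _) => t t0; field; rewrite !gt_eqF.
have d0 : sieve_cdf N (m N) - poisson_cdf (sieve_mass N) (m N) @[N --> \oo] --> (0 : R).
  apply: (@squeeze_cvgr _ _ _ _ (fun N => - (D' * (loglog N)^-1)) (fun N => D' * (loglog N)^-1)).
  - apply: filterS HD' => N /(_ (m N)); by rewrite ler_norml.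
  - rewrite -oppr0 -(mulr0 D'); apply: cvgN; exact: cvgMl_tmp.
  - rewrite -[X in _ --> X](mulr0 D'); exact: cvgMl_tmp.
rewrite -[X in _ --> X]add0r.
have -> : (fun N => sieve_cdf N (m N)) =
    (fun N => sieve_cdf N (m N) - poisson_cdf (sieve_mass N) (m N) +
              poisson_cdf (sieve_mass N) (m N)) by apply/funext => N; rewrite subrK.
exact: cvgD.
Unshelve. all: by end_near. Qed.

End ErdosKac.

(** * Prime factors with multiplicity *)

Section BigOmega.
Context {R : realType}.

(** The differences 1/(p - 1) - 1/p telescope when extended to all integers from 2 on. *)
Lemma sum_inv_pred_prime_le n :
  \sum_(0 <= p < n.+1 | prime p) (p%:R - 1)^-1 <= prime_recip_sum n + 1 :> R.
Proof.
case: n => [|n].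
  by rewrite /prime_recip_sum !(big_mkcond prime) !big_nat1 ?add0r /= ?add0r ?ler01.
suff h : \sum_(0 <= p < n.+2 | prime p) (p%:R - 1)^-1 <=
    prime_recip_sum n.+1 + (1 - n.+1%:R^-1) :> R.
  by apply: le_trans h _; rewrite lerD2l lerBlDr lerDl invr_ge0.
rewrite /prime_recip_sum; elim: n => [|n IH].
  by rewrite !(big_mkcond prime) !big_nat_recr//= ?big_geq// invr1 subrr !addr0.
rewrite !(big_mkcond prime) !(big_nat_recr n.+2)//= -!big_mkcond /=.
have e : n.+2%:R - 1 = n.+1%:R :> R by rewrite -[n.+2%:R]natr1 addrK.
have le : n.+2%:R^-1 <= n.+1%:R^-1 :> R by rewrite lef_pV2 ?posrE// ler_nat.
move: IH le; rewrite e; case: ifP => _; rewrite ?addr0.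
  by move: (n.+1%:R^-1) (n.+2%:R^-1) => u v; lra.
by move: (n.+1%:R^-1) (n.+2%:R^-1) => u v; lra.
Qed.

Lemma sum_logn p N : (\sum_(1 <= n < N.+1) logn p n = logn p N`!)%N.
Proof.
elim: N => [|N IH]; first by rewrite big_nil fact0 logn1.
by rewrite big_nat_recr//= IH factS lognM ?fact_gt0// addnC.
Qed.

Lemma sum_bigomega_le N :
  \sum_(1 <= n < N.+1) (bigomega N n)%:R <= N%:R * (prime_recip_sum N + 1) :> R.
Proof.
rewrite -natr_sum exchange_big /= natr_sum.
apply: (@le_trans _ _ (N%:R * \sum_(0 <= p < N.+1 | prime p) (p%:R - 1)^-1)); last first.
  by rewrite ler_wpM2l// sum_inv_pred_prime_le.
rewrite mulr_sumr ler_sum// => p pp; rewrite sum_logn logn_fact// natr_sum.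
apply: (@le_trans _ _ (N%:R * \sum_(1 <= k < N.+1) (p%:R ^+ k)^-1)).
  by rewrite mulr_sumr ler_sum// => k _; rewrite -natrX; exact: natr_divn_le.
by rewrite ler_wpM2l// sum_inv_exp_le// prime_gt1.
Qed.

Lemma sum_omega_in_ge M (P : {set 'I_M.+1}) : (forall p, p \in P -> (0 < p)%N) ->
  M%:R * \sum_(p in P) p%:R^-1 - #|P|%:R <= \sum_(1 <= n < M.+1) (omega_in P n)%:R :> R.
Proof.
move=> P0; rewrite -natr_sum.
have -> : (\sum_(1 <= n < M.+1) omega_in P n = \sum_(p in P) M %/ p)%N.
  under [RHS]eq_bigr do rewrite divn_count_dvd.
  rewrite exchange_big /=; apply: eq_bigr => n _.
  rewrite /omega_in -sum1_card big_mkcond [RHS]big_mkcond /=.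
  by apply: eq_bigr => p _; rewrite inE; case: (p \in P) => //=; case: dvdn.
rewrite natr_sum mulr_sumr -sum1_card natr_sum -sumrB ler_sum// => p pP.
by rewrite natr_divn_ge// P0.
Qed.

Lemma omega_in_le_bigomega M (P : {set 'I_M.+1}) n : (0 < n)%N ->
  (forall p, p \in P -> prime p) -> (omega_in P n <= bigomega M n)%N.
Proof.
move=> n0 Pp; rewrite /omega_in /bigomega big_mkord -sum1_card.
rewrite big_mkcond [leqRHS]big_mkcond leq_sum// => p _; rewrite inE.
case: ifP => // /andP[/Pp pp pn]; rewrite pp.
by rewrite logn_gt0 mem_primes pp n0 pn.
Qed.

(** Markov's inequality for Omega - W >= 0: with q the fourth root of log log N, the mean is at most
    C + 2 + D q, against a threshold eps q^2. *)
Lemma bigomega_near_omega (eps : R) : 0 < eps -> \forall N \near \oo,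
  (\sum_(1 <= n < N.+1) ((omega_in (sieve_primes (R:=R) N) n)%:R +
     eps * Num.sqrt (loglog N) < (bigomega N n)%:R :> R)%R)%:R <= eps * N%:R.
Proof.
move=> e0; have [C [C0 HC]] := @mertens_second R.
have [D D0 HD] := @sieve_mass_bounds R.
have sy : Num.sqrt (loglog N) @[N --> \oo] --> (+oo : set_system R).
  by apply: cvg_sqrt_pinfty; exact: cvg_loglog.
have qy := cvg_sqrt_pinfty sy.
near=> N.
have [N0 NE l5 low1 lowhi hiN low_ge low_le hi_ge hi_le] : @sieve_spec R N.
  by near: N; exact: sieveP.
have [_] : sieve_mass N <= loglog N + D /\
    `|sieve_mass N - loglog N| <= D * Num.sqrt (Num.sqrt (loglog N)) by near: N.
have q1 : 1 <= Num.sqrt (Num.sqrt (loglog N)) :> R by near: N; exact: (cvgry_ge qy).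
have qe : (C + 2 + D) / eps ^+ 2 <= Num.sqrt (Num.sqrt (loglog N)).
  by near: N; exact: (cvgry_ge qy).
set q := Num.sqrt (Num.sqrt _) in q1 qe *; rewrite ler_norml => /andP[hm _].
have sq : Num.sqrt (loglog N) = q ^+ 2 by rewrite sqr_sqrtr.
have N1 : (1 < N)%N by apply: leq_trans hiN; exact: leq_trans lowhi.
have NR0 : 0 < N%:R :> R by rewrite ltr0n.
have := HC _ N1; rewrite -/(loglog N) ler_norml => /andP[_ hp].
have P0 p : p \in sieve_primes (R:=R) N -> (0 < p)%N.
  by rewrite inE => /andP[/prime_gt0].
have up := sum_bigomega_le N.
have lo := sum_omega_in_ge P0.
have cP : #|sieve_primes (R:=R) N|%:R <= N%:R :> R.
  by rewrite ler_nat (leq_trans (card_sieve_primes_le _)).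
have eq0 : 0 < eps * q ^+ 2 by rewrite mulr_gt0// exprn_gt0// (lt_le_trans _ q1).
have mk : eps * q ^+ 2 * (\sum_(1 <= n < N.+1) ((omega_in (sieve_primes (R:=R) N) n)%:R +
     eps * Num.sqrt (loglog N) < (bigomega N n)%:R :> R)%R)%:R <=
   \sum_(1 <= n < N.+1) (bigomega N n)%:R -
   \sum_(1 <= n < N.+1) (omega_in (sieve_primes (R:=R) N) n)%:R.
  rewrite natr_sum mulr_sumr -sumrB big_nat_cond [leRHS]big_nat_cond ler_sum// => n.
  move=> /andP[/andP[n0 _] _]; rewrite sq.
  case: ltP => [h|_]; first by rewrite mulr1; lra.
  rewrite mulr0 subr_ge0 ler_nat omega_in_le_bigomega// => p.
  by rewrite inE => /andP[].
rewrite -(ler_pM2l eq0); apply: (le_trans mk).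
have -> : eps * q ^+ 2 * (eps * N%:R) = N%:R * (q * (q * eps ^+ 2)) by ring.
move: qe; rewrite ler_pdivrMr ?exprn_gt0// => qe.
apply: (@le_trans _ _ (N%:R * (C + 2 + D * q))).
  move: up lo; rewrite -/(sieve_mass N).
  move: (\sum_(_ <= _ < _) _) (\sum_(_ <= _ < _) _) (sieve_mass N) (prime_recip_sum N) hp hm => A B m P hp hm up lo.
  have : N%:R * (P + 1) - (N%:R * m - N%:R) <= N%:R * (C + 2 + D * q).
    have -> : N%:R * (P + 1) - (N%:R * m - N%:R) = N%:R * (P + 2 - m) by ring.
    by rewrite ler_pM2l//; lra.
  by lra.
rewrite ler_pM2l//.
apply: (@le_trans _ _ (q * (C + 2 + D))); first by nra.
by rewrite ler_pM2l//; lra.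
Unshelve. all: by end_near. Qed.
End BigOmega.

(** * From prime factors to representations *)

Section Transfer.
Context {R : realType}.

Lemma normalized_log_count_le (a n : nat) (z : R) : 0 < loglog (R:=R) n ->
  (normalized_log_count R a n <= z%:E)%E =
  (repr_count n a == 0%N) ||
  (ln (repr_count n a)%:R <= ln 3 * (loglog n + z * Num.sqrt (loglog n))).
Proof.
move=> l0; have l3 : 0 < ln 3 :> R by rewrite ln_gt0// ltr1n.
have d0 : 0 < ln 3 * Num.sqrt (loglog n) :> R by rewrite mulr_gt0// sqrtr_gt0.
rewrite /normalized_log_count -/(loglog n) inver gt_eqF// lee_pdivrMr// -EFinM.
have [->|c0] := posnP; first by rewrite le0_lneNy// addNye leNye.
rewrite lne_EFin ?ltr0n// -EFinB lee_fin lerBlDr /=.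
by congr (_ <= _); ring.
Qed.

(** A prime above 2 a cannot divide it. *)
Lemma omega_in_le_count (a N n : nat) : (2 * a <= sieve_low (R:=R) N)%N -> (0 < a)%N -> (0 < n)%N ->
  (omega_in (sieve_primes (R:=R) N) n <= count (coprime (2 * a)) (primes n))%N.
Proof.
move=> low a0 n0; rewrite /omega_in -size_filter cardE -(size_map val); apply: uniq_leq_size.
  by rewrite map_inj_uniq ?enum_uniq//; exact: val_inj.
move=> x /mapP[p]; rewrite mem_enum !inE => /andP[/andP[pp /andP[pl _]] pn] ->.
rewrite mem_filter mem_primes pp n0 pn andbT coprime_sym prime_coprime//.
by rewrite gtnNdvd ?muln_gt0// (leq_ltn_trans low).
Qed.

Lemma sum_lt_le (x : R) N : 0 <= x -> (\sum_(1 <= n < N.+1) (n%:R < x)%R)%:R <= x.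
Proof.
move=> x0; have tx : (Num.truncn x)%:R <= x by rewrite truncn_le.
apply: le_trans tx; rewrite ler_nat.
have h : (\sum_(1 <= n < N.+1) (n <= Num.truncn x) <= minn N (Num.truncn x))%N.
  elim: N => [|N IH]; first by rewrite big_nil.
  rewrite big_nat_recr//=; have step S T : (S <= minn N T -> S + (N.+1 <= T) <= minn N.+1 T)%N by lia.
  exact: step.
apply: leq_trans (leq_trans h (geq_minr _ _)); apply: leq_sum => n _.
by case: ltP => // /ltW nx; rewrite truncn_ge_nat// nx.
Qed.

Lemma distribution_countE (a : nat) (z : R) N : distribution_count a z N =
  (\sum_(1 <= n < N.+1) ((3 <= n) && (normalized_log_count R a n <= z%:E)%E))%N.
Proof.
rewrite /distribution_count -sum1_card big_mkcond /=.
under eq_bigr do rewrite inE.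
pose F n := nat_of_bool ((3 <= n)%N && (normalized_log_count R a n <= z%:E)%E).
transitivity (\sum_(n < N.+1) F n)%N; first by apply: eq_bigr => n _; rewrite /F; case: ifP.
by rewrite -(big_mkord xpredT F) big_ltn.
Qed.

(** For large N, log n >= log N + log eps >= (log N) / 2, and halving the logarithm lowers log log
    by ln 2 <= 1. *)
Lemma loglog_near (eps : R) : 0 < eps -> \forall N \near \oo, forall n,
  (n <= N)%N -> eps * N%:R <= n%:R ->
  (3 <= n)%N /\ loglog N - 1 <= loglog (R:=R) n <= loglog N.
Proof.
move=> e0; near=> N => n nN en.
have N0 : (0 < N)%N by near: N; exact: nbhs_infty_gt.
have NR0 : 0 < N%:R :> R by rewrite ltr0n.
have nR0 : 0 < n%:R :> R by apply: lt_le_trans en; exact: mulr_gt0.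
have l0 : 0 < loglog N :> R by near: N; exact: (cvgry_gt cvg_loglog).
have l1 : ln (2 * (1 + `|ln eps|)) <= loglog N by near: N; exact: (cvgry_ge cvg_loglog).
have L0 : 0 < ln (N%:R : R).
  by rewrite ltNge; apply/negP => L0; move: l0; rewrite /loglog ln0// ltxx.
have n3 : (3 <= n)%N.
  rewrite -(ler_nat R); apply: le_trans en; rewrite mulrC -ler_pdivrMr//.
  by near: N; exact: (cvgry_ge cvgr_idn).
have {}l1 : 2 * (1 + `|ln eps|) <= ln N%:R.
  by move: l1; rewrite /loglog ler_ln ?posrE// mulr_gt0// ltr_wpDr.
have Ln : ln N%:R / 2 <= ln (n%:R : R).
  have : ln (eps * N%:R) <= ln n%:R by rewrite ler_ln ?posrE ?mulr_gt0.
  rewrite lnM ?posrE//; have := ler_norm (- ln eps); rewrite normrN.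
  by move: (ln eps) `|ln eps| (ln N%:R) (ln n%:R) l1 => u v w x; lra.
have ln2 := @ln_le_sub1 R 2 (ltr0Sn _ _).
split=> //; apply/andP; split.
  apply: (@le_trans _ _ (ln (ln N%:R / 2))); last by rewrite ler_ln ?posrE ?divr_gt0// (lt_le_trans _ Ln)// divr_gt0.
  rewrite ln_div ?posrE// -/(loglog N); move: (ln 2) ln2 => x; lra.
by rewrite /loglog ler_ln ?posrE ?(lt_le_trans _ Ln) ?divr_gt0// ler_ln ?posrE// ler_nat.
Unshelve. all: by end_near. Qed.

(** On the scale of base 3 logarithms, W - C <= log R(n; a) <= Omega. Passing from log log n to log
    log N costs 1, and |z| through the square root; with C these fit in one eps sqrt(log log N). The
    converse spends a second eps on Omega - W. *)
Lemma typical_transfer (a N n C : nat) (z eps : R) : (0 < a)%N -> (0 < n <= N)%N ->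
  (2 : R) <= loglog N -> 0 < eps -> C%:R + 1 + `|z| <= eps * Num.sqrt (loglog N) ->
  (omega_in (sieve_primes (R:=R) N) n <= count (coprime (2 * a)) (primes n))%N ->
  loglog N - 1 <= loglog (R:=R) n <= loglog N ->
  (3 ^ count (coprime (2 * a)) (primes n) <= 3 ^ C * repr_count n a)%N ->
  ((normalized_log_count R a n <= z%:E)%E ->
    (omega_in (sieve_primes (R:=R) N) n)%:R <= loglog N + (z + eps) * Num.sqrt (loglog N)) /\
  ((bigomega N n)%:R <= (omega_in (sieve_primes (R:=R) N) n)%:R + eps * Num.sqrt (loglog N) ->
   (omega_in (sieve_primes (R:=R) N) n)%:R <= loglog N + (z - 2 * eps) * Num.sqrt (loglog N) ->
   (normalized_log_count R a n <= z%:E)%E).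
Proof.
move=> a0 nN l2 e0 Cz Wc /andP[ly yl] cC.
have y0 : 0 < loglog n :> R by clear -ly l2; lra.
have l3 : 0 < ln 3 :> R by rewrite ln_gt0// ltr1n.
have l0 : 0 <= loglog N :> R by clear -l2; lra.
have sE : Num.sqrt (loglog N) ^+ 2 = loglog N :> R by rewrite sqr_sqrtr.
have ts : Num.sqrt (loglog n) <= Num.sqrt (loglog N) :> R by rewrite ler_wsqrtr.
have st : Num.sqrt (loglog N) - 1 <= Num.sqrt (loglog n) :> R.
  have s1 : 1 <= Num.sqrt (loglog N) :> R.
    by rewrite -[leLHS]sqrtr1 ler_wsqrtr//; clear -l2; lra.
  rewrite -(@ler_pXn2r _ 2) ?nnegrE ?sqrtr_ge0 ?subr_ge0// sqr_sqrtr ?(ltW y0)//.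
  by rewrite sqrrB expr1n mulr1 sE; clear -s1 ly; lra.
have zts : z * Num.sqrt (loglog n) <= z * Num.sqrt (loglog N) + `|z| /\
    z * Num.sqrt (loglog N) <= z * Num.sqrt (loglog n) + `|z|.
  have := ler_norm z; have := ler_norm (- z); rewrite normrN => h1 h2.
  have := normr_ge0 z; clear -ts st h1 h2; split; nra.
(* The last hypothesis excludes a zero count, hence the value -oo. *)
have c0 : (0 < repr_count n a)%N.
  by rewrite lt0n; apply: contraTneq cC => ->; rewrite muln0 -ltnNge expn_gt0.
have lnX k : ln ((3 ^ k)%N%:R) = ln 3 * k%:R :> R by rewrite natrX lnXn// mulr_natr.
have cR0 : 0 < (repr_count n a)%:R :> R by rewrite ltr0n.
have lc : ln 3 * (count (coprime (2 * a)) (primes n))%:R <=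
    ln 3 * C%:R + ln (repr_count n a)%:R :> R.
  rewrite -!lnX -lnM ?posrE ?ltr0n ?expn_gt0// -natrM ler_ln ?posrE ?ltr0n ?muln_gt0 ?expn_gt0//.
  by rewrite ler_nat.
have uc : ln (repr_count n a)%:R <= ln 3 * (bigomega N n)%:R :> R.
  by rewrite -lnX ler_ln ?posrE ?ltr0n ?expn_gt0// ler_nat repr_count_le.
rewrite normalized_log_count_le// gtn_eqF//=.
move: Wc; rewrite -(ler_nat R) => Wc; case: zts => z1 z2; have C0 : 0 <= C%:R :> R by [].
split.
  move=> h; apply: le_trans Wc _.
  have : ln 3 * (count (coprime (2 * a)) (primes n))%:R <=
      ln 3 * (C%:R + (loglog n + z * Num.sqrt (loglog n))) :> R by rewrite mulrDr; clear -lc h; lra.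
  by rewrite ler_pM2l// => {}h; clear -h z1 yl Cz C0; lra.
move=> h1 h2; apply: (le_trans uc); rewrite ler_pM2l//.
by clear -h1 h2 z2 ly Cz C0; lra.
Qed.
End Transfer.

Lemma bool_le_add (b d e1 e2 e3 : bool) : (~~ e1 -> ~~ e2 -> ~~ e3 -> b -> d) ->
  (b <= d + (e1 + e2 + e3))%N.
Proof. by case: b d e1 e2 e3 => [] [] [] [] [] // /(_ isT isT isT isT). Qed.

(* Each of the three sets of exceptional n contributes eps N: the n < eps N, those
   excluded in [repr_count_lower], and those excluded in [bigomega_near_omega]. *)
Lemma distribution_count_sandwich (R : realType) (a : nat) (z eps : R) : (0 < a)%N -> 0 < eps ->
  \forall N \near \oo,
  (\sum_(1 <= n < N.+1) ((omega_in (sieve_primes (R:=R) N) n)%:R <=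
     loglog N + (z - 2 * eps) * Num.sqrt (loglog N))%R)%:R - 3 * eps * N%:R <=
  (distribution_count a z N)%:R <=
  (\sum_(1 <= n < N.+1) ((omega_in (sieve_primes (R:=R) N) n)%:R <=
     loglog N + (z + eps) * Num.sqrt (loglog N))%R)%:R + 3 * eps * N%:R.
Proof.
move=> a0 e0; have [C HC] := @repr_count_lower R a a0.
have {}HC := HC _ e0; have HO := bigomega_near_omega e0; have HL := loglog_near e0.
have cl := @cvg_loglog R; have sy := cvg_sqrt_pinfty cl.
near=> N.
have N0 : (0 < N)%N by near: N; exact: nbhs_infty_gt.
have HCN : (\sum_(1 <= n < N.+1) ~~ (3 ^ count (coprime (2 * a)) (primes n) <=
    3 ^ C * repr_count n a)%N)%:R <= eps * N%:R by near: N.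
have HON : (\sum_(1 <= n < N.+1) ((omega_in (sieve_primes (R:=R) N) n)%:R +
     eps * Num.sqrt (loglog N) < (bigomega N n)%:R :> R)%R)%:R <= eps * N%:R by near: N.
have HLN : forall n, (n <= N)%N -> eps * N%:R <= n%:R ->
  (3 <= n)%N /\ (loglog N - 1 <= loglog (R:=R) n <= loglog N) by near: N.
have HS : (\sum_(1 <= n < N.+1) (n%:R < eps * N%:R)%R)%:R <= eps * N%:R.
  by apply: sum_lt_le; rewrite mulr_ge0// ltW.
have l2 : 2 <= loglog N :> R by near: N; exact: (cvgry_ge cl).
have Cz : C%:R + 1 + `|z| <= eps * Num.sqrt (loglog N).
  by rewrite mulrC -ler_pdivrMr//; near: N; exact: (cvgry_ge sy).
have low : (2 * a <= sieve_low (R:=R) N)%N.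
  have [_ NE l50 _ _ _ low_ge _ _ _] : @sieve_spec R N by near: N; exact: sieveP.
  rewrite -(ler_nat R) (le_trans _ low_ge)//.
  have la : (2 * a)%N%:R <= loglog N :> R by near: N; exact: (cvgry_ge cl).
  have e1 := expR_ge1Dx (loglog N : R).
  apply: (@le_trans _ _ (expR (loglog N))); first by clear -la e1; lra.
  by rewrite ler_eXnr//; clear -e1 l50; lra.
have key n : (0 < n <= N)%N -> (eps * N%:R <= n%:R) ->
    (3 ^ count (coprime (2 * a)) (primes n) <= 3 ^ C * repr_count n a)%N ->
    ((3 <= n)%N && (normalized_log_count R a n <= z%:E)%E ->
      (omega_in (sieve_primes (R:=R) N) n)%:R <= loglog N + (z + eps) * Num.sqrt (loglog N)) /\
    ((bigomega N n)%:R <= (omega_in (sieve_primes (R:=R) N) n)%:R + eps * Num.sqrt (loglog N) ->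
     (omega_in (sieve_primes (R:=R) N) n)%:R <= loglog N + (z - 2 * eps) * Num.sqrt (loglog N) ->
     (3 <= n)%N && (normalized_log_count R a n <= z%:E)%E).
  move=> /[dup] nN /andP[n0 n1] en cC; have [n3 ln] := HLN _ n1 en.
  have Wc := omega_in_le_count low a0 n0.
  have [h1 h2] := typical_transfer a0 nN l2 e0 Cz Wc ln cC.
  by rewrite n3; split.
have -> : 3 * eps * N%:R = eps * N%:R + eps * N%:R + eps * N%:R by ring.
rewrite distribution_countE lerBlDr; apply/andP; split;
    apply: le_trans (lerD (lexx _) (lerD (lerD HS HCN) HON));
    rewrite -!natrD ler_nat -!big_split/= big_nat_cond [leqRHS]big_nat_cond leq_sum// => n;
    move=> /andP[/andP[n0 nN] _]; apply: bool_le_add; rewrite -leNgt negbK -leNgt => en cC om.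
- by apply: (key _ _ en cC).2 om; rewrite n0 -ltnS.
- by apply: (key _ _ en cC).1; rewrite n0 -ltnS.
Unshelve. all: by end_near. Qed.

Theorem theorem3 (R : realType) (a : nat) (ha : (0 < a)%N) (z : R) :
  (fun N : nat => (1 / N%:R * (distribution_count a z N)%:R : R)) @ \oo --> Phi z.
Proof.
(* The lower side spends 3 d in the sandwich, d in the convergence and 2 d in moving [Phi] from z -
   2 d to z. *)
apply/cvgrPdist_le => e e0; pose d := e / 6.
have d0 : 0 < d by rewrite divr_gt0.
have H := distribution_count_sandwich z ha d0.
have up := @cvg_sieve_cdf R (z + d); have lo := @cvg_sieve_cdf R (z - 2 * d).
move/cvgrPdist_le: up => /(_ _ d0) up; move/cvgrPdist_le: lo => /(_ _ d0) lo.
near=> N.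
have NR0 : 0 < N%:R :> R by rewrite ltr0n; near: N; exact: nbhs_infty_gt.
have : (\sum_(1 <= n < N.+1) ((omega_in (sieve_primes (R:=R) N) n)%:R <=
     loglog N + (z - 2 * d) * Num.sqrt (loglog N))%R)%:R - 3 * d * N%:R <=
  (distribution_count a z N)%:R <=
  (\sum_(1 <= n < N.+1) ((omega_in (sieve_primes (R:=R) N) n)%:R <=
     loglog N + (z + d) * Num.sqrt (loglog N))%R)%:R + 3 * d * N%:R by near: N.
have : `|Phi (z + d) - (\sum_(1 <= n < N.+1) ((omega_in (sieve_primes (R:=R) N) n)%:R <=
     loglog N + (z + d) * Num.sqrt (loglog N))%R)%:R / N%:R| <= d by near: N.
have : `|Phi (z - 2 * d) - (\sum_(1 <= n < N.+1) ((omega_in (sieve_primes (R:=R) N) n)%:R <=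
     loglog N + (z - 2 * d) * Num.sqrt (loglog N))%R)%:R / N%:R| <= d by near: N.
move=> h1 h2 /andP[lb ub].
move: lb; rewrite -(ler_pM2r (_ : 0 < N%:R^-1)) ?invr_gt0// mulrBl mulfK ?gt_eqF// => lb.
move: ub; rewrite -(ler_pM2r (_ : 0 < N%:R^-1)) ?invr_gt0// mulrDl mulfK ?gt_eqF// => ub.
rewrite div1r [_^-1 * _]mulrC; move: h1 h2.
have /andP[_ p1] : 0 <= Phi (z + d) - Phi z <= z + d - z by apply: Phi_lipschitz; rewrite lerDl ltW.
have /andP[_ p2] : 0 <= Phi z - Phi (z - 2 * d) <= z - (z - 2 * d).
  by apply: Phi_lipschitz; rewrite gerBl mulr_ge0// ltW.
have ed : e = 6 * d by rewrite /d; field.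
rewrite !ler_norml => /andP[h1 h2] /andP[h3 h4].
apply/andP; split; clear -p1 p2 ed h1 h2 h3 h4 lb ub d0; lra.
Unshelve. all: by end_near. Qed.
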